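(* In general, neither the tangent cone nor the equimultiple locus of a Puiseux surface can be obtained from the set of exponents of a series defining it (nor, therefore, from a subset of it). Precisely: (1) There exist a positive integer $m$ and Puiseux power series $\zeta_1,\zeta_2\in\mathbf{C}[[X^{1/m},Y^{1/m}]]$ with $\Delta(\zeta_1)=\Delta(\zeta_2)$, $\Delta(\zeta_1)\cap(m\mathbf{Z})^2=\emptyset$ and $\nu(\zeta_1)=\nu(\zeta_2)<1$, such that the equations of the tangent cones of the surfaces defined by $\zeta_1$ and $\zeta_2$ are products of linear forms with different numbers of distinct (pairwise non-proportional) linear factors. (2) There exist a positive integer $m$ and Puiseux power series $\zeta_1,\zeta_2\in\mathbf{C}[[X^{1/m},Y^{1/m}]]$ with $\Delta(\zeta_1)=\Delta(\zeta_2)$ and $\Delta(\zeta_1)\cap(m\mathbf{Z})^2=\emptyset$, such that the equimultiple locus of the surface defined by $\zeta_1$ contains a prime of height $1$, while the equimultiple locus of the surface defined by $\zeta_2$ consists only of the closed point $(X,Y,Z)$.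
   Context: For a positive integer $m$, elements of $\mathbf{C}[[X^{1/m},Y^{1/m}]]$ are called Puiseux power series. For $\zeta=\sum_{(i,j)\in\Delta(\zeta)}c_{ij}X^{i/m}Y^{j/m}$ with all $c_{ij}\neq0$, $\Delta(\zeta)\subset\mathbf{N}^2$ is called the set of exponents of $\zeta$. The order $\nu$ is the usual one, with $\nu(X^{i/m}Y^{j/m})=(i+j)/m$. Let $K=\mathbf{C}((X,Y))$ be the fraction field of $\mathbf{C}[[X,Y]]$. The surface defined by $\zeta$ is the irreducible embedded algebroid surface $\mathrm{Spec}(\mathbf{C}[[X,Y,Z]]/(F))$, where $F(Z)\in\mathbf{C}[[X,Y]][Z]$ is the minimal polynomial of $\zeta$ over $K$. The equation of the tangent cone of this surface is the initial form of $F$, i.e. its lowest-degree homogeneous part in $X,Y,Z$, up to a nonzero constant factor. The equimultiple locus of $\mathrm{Spec}(\mathbf{C}[[X,Y,Z]]/(F))$ is the set of primes $P\subset\mathbf{C}[[X,Y,Z]]$ such that $F\in P^{(\nu(F))}$, where $P^{(r)}$ is the $r$-th symbolic power and $\nu(F)$ is the usual order of $F$. A prime of height $1$ in the equimultiple locus is one whose image in $\mathbf{C}[[X,Y,Z]]/(F)$ has height $1$. *)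

(* Defs.v *)
From HB Require Import structures.
From mathcomp Require Import all_boot all_order all_algebra.
(* mpoly has to come before the classical files: in the other order the       *)
(* levels of their notations clash.                                           *)
From mathcomp Require Import mpoly.
From mathcomp Require Import boolp classical_sets reals constructive_ereal.
From mathcomp Require Import complex.

Set Implicit Arguments.
Unset Strict Implicit.
Unset Printing Implicit Defensive.

Import Order.TTheory GRing.Theory Num.Theory.

Local Open Scope ring_scope.
Local Open Scope classical_set_scope.

Record fps (n : nat) (R : Type) := Fps { fps_coef : 'X_{1..n} -> R }.

Arguments Fps {n R}.

Definition fps_var (n : nat) (R : comNzRingType) (i : 'I_n) : fps n R :=
  Fps (fun u => (u == U_(i)%MM)%:R).

Section FpsRing.
Context (n : nat) (R : comNzRingType).
Implicit Types f g h : fps n R.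

Lemma fpsP f g : (forall m, fps_coef f m = fps_coef g m) <-> f = g.
Proof.
split=> [|->//]; case: f g => [f] [g] /= e.
by congr Fps; apply/funext.
Qed.

HB.instance Definition _ := gen_eqMixin (fps n R).
HB.instance Definition _ := gen_choiceMixin (fps n R).

Definition fps_zero : fps n R := Fps (fun=> 0).
Definition fps_one : fps n R := Fps (fun m => (m == 0%MM)%:R).
Definition fps_add f g := Fps (fun m => fps_coef f m + fps_coef g m).
Definition fps_opp f := Fps (fun m => - fps_coef f m).
(* The bound on the degree only makes the index type finite. *)
Definition fps_mul f g := Fps (fun m =>
  \sum_(k : 'X_{1..n < (mdeg m).+1} | (k <= m)%MM)
     fps_coef f k * fps_coef g (m - k)%MM).

Fact fps_addA : associative fps_add.
Proof. by move=> f g h; apply/fpsP => m /=; rewrite addrA. Qed.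
Fact fps_addC : commutative fps_add.
Proof. by move=> f g; apply/fpsP => m /=; rewrite addrC. Qed.
Fact fps_add0 : left_id fps_zero fps_add.
Proof. by move=> f; apply/fpsP => m /=; rewrite add0r. Qed.
Fact fps_addN : left_inverse fps_zero fps_opp fps_add.
Proof. by move=> f; apply/fpsP => m /=; rewrite addNr. Qed.

HB.instance Definition _ :=
  GRing.isZmodule.Build (fps n R) fps_addA fps_addC fps_add0 fps_addN.

Definition fps_trunc (d : nat) f : {mpoly R[n]} :=
  \sum_(u : 'X_{1..n < d}) fps_coef f u *: 'X_[u].

Lemma fps_truncE d f m :
  (fps_trunc d f)@_m = if (mdeg m < d)%N then fps_coef f m else 0.
Proof.
rewrite /fps_trunc raddf_sum /=; case: ifPn => hm.
  rewrite (bigD1 (BMultinom hm)) //= mcoeffZ mcoeffX eqxx mulr1 big1 ?addr0 //.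
  move=> u; rewrite bmeqP /= => /negPf hu.
  by rewrite mcoeffZ mcoeffX hu mulr0.
rewrite big1 // => u _; rewrite mcoeffZ mcoeffX.
case: eqP => [e|_]; last by rewrite mulr0.
by move: hm; rewrite -e; case: u {e} => /= u ->.
Qed.

Lemma mcoeffM_lin (p q : {mpoly R[n]}) (m : 'X_{1..n}) :
  (p * q)@_m = \sum_(k : 'X_{1..n < (mdeg m).+1} | (k <= m)%MM)
                  p@_k * q@_(m - k).
Proof. exact: mcoeff_poly_mul_lin. Qed.

Lemma fps_mulE d f g m (p q : {mpoly R[n]}) : (mdeg m < d)%N ->
  (forall u, (mdeg u < d)%N -> p@_u = fps_coef f u) ->
  (forall u, (mdeg u < d)%N -> q@_u = fps_coef g u) ->
  fps_coef (fps_mul f g) m = (p * q)@_m.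
Proof.
move=> hm hp hq; rewrite mcoeffM_lin /=; apply: eq_bigr => k hk.
rewrite hp ?hq //; last by apply: leq_ltn_trans hm; rewrite -ltnS; case: (k).
by apply: leq_ltn_trans hm; rewrite mdegB.
Qed.

Lemma fps_trunc_coef d f u :
  (mdeg u < d)%N -> (fps_trunc d f)@_u = fps_coef f u.
Proof. by rewrite fps_truncE => ->. Qed.

Lemma fps_trunc_mul d f g u : (mdeg u < d)%N ->
  (fps_trunc d f * fps_trunc d g)@_u = fps_coef (fps_mul f g) u.
Proof.
by move=> hu; symmetry; apply: (fps_mulE hu) => v; apply: fps_trunc_coef.
Qed.

Fact fps_mulA : associative fps_mul.
Proof.
move=> f g h; apply/fpsP => m; have hm := ltnSn (mdeg m).
rewrite (fps_mulE hm (@fps_trunc_coef _ f) (@fps_trunc_mul _ g h)).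
by rewrite (fps_mulE hm (@fps_trunc_mul _ f g) (@fps_trunc_coef _ h)) mulrA.
Qed.

Fact fps_mulC : commutative fps_mul.
Proof.
move=> f g; apply/fpsP => m; have hm := ltnSn (mdeg m).
by rewrite -(fps_trunc_mul _ _ hm) mulrC (fps_trunc_mul _ _ hm).
Qed.

Fact fps_mul1 : left_id fps_one fps_mul.
Proof.
move=> f; apply/fpsP => m; have hm := ltnSn (mdeg m).
rewrite (@fps_mulE _ _ _ _ 1 _ hm _ (@fps_trunc_coef _ f)).
  by rewrite mul1r fps_trunc_coef.
by move=> u _; rewrite mcoeff1.
Qed.

Fact fps_mulDl : left_distributive fps_mul fps_add.
Proof.
move=> f g h; apply/fpsP => m /=; rewrite -big_split /=.
by apply: eq_bigr => k _; rewrite mulrDl.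
Qed.

Fact fps_one_neq0 : fps_one != 0.
Proof.
by apply/eqP => /fpsP /(_ 0%MM) /=; rewrite eqxx; apply/eqP/oner_neq0.
Qed.

HB.instance Definition _ := GRing.Zmodule_isComNzRing.Build (fps n R)
  fps_mulA fps_mulC fps_mul1 fps_mulDl fps_one_neq0.

Definition fps_unit : {pred fps n R} := fun f => `[< exists g, g * f = 1 >].
Definition fps_inv f : fps n R :=
  if pselect (exists g, g * f = 1) is left e then projT1 (cid e) else f.

Fact fps_mulV : {in fps_unit, left_inverse 1 fps_inv *%R}.
Proof.
move=> f /asboolP hf; rewrite /fps_inv.
by case: pselect => // e; case: (cid e).
Qed.
Fact fps_unitP f g : g * f = 1 -> f \in fps_unit.
Proof. by move=> e; apply/asboolP; exists g. Qed.
Fact fps_inv_out : {in [predC fps_unit], fps_inv =1 id}.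
Proof.
move=> f; rewrite inE => /asboolP hf; rewrite /fps_inv.
by case: pselect.
Qed.

HB.instance Definition _ := GRing.ComNzRing_hasMulInverse.Build (fps n R)
  fps_mulV fps_unitP fps_inv_out.

End FpsRing.

Section FpsIdomain.
Context (n : nat) (R : idomainType).
Implicit Types f g : fps n R.

Lemma fps_min_coef f : f != 0 ->
  exists m, fps_coef f m != 0 /\
    (forall u, (u < m)%O -> fps_coef f u = 0).
Proof.
move=> /eqP f0; apply: contrapT => h; apply: f0; apply/fpsP => m /=.
elim/(ltmwf (n := n)): m => m ih; apply/eqP/negPn/negP => hm.
by apply: h; exists m; split=> // u /ih ->.
Qed.

Fact fps_idomainP f g : f * g = 0 -> (f == 0) || (g == 0).
Proof.
move=> fg0; case: (eqVneq f 0) => //= /fps_min_coef [a [fa0 fa]].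
apply/negPn/negP => /fps_min_coef [b [gb0 gb]].
move/fpsP/(_ (a + b)%MM): fg0 => /=.
have ha : (mdeg a < (mdeg (a + b)).+1)%N by rewrite ltnS mdegD leq_addr.
rewrite (bigD1 (BMultinom ha)) /=; last by rewrite lem_addr.
have -> : (a + b - a)%MM = b by rewrite addmC addmK.
rewrite big1 ?addr0.
  by move/eqP; rewrite mulf_eq0 (negPf fa0) (negPf gb0).
move=> k /andP[hk]; rewrite bmeqP /= => hne.
case: (ltgtP (k : 'X_{1..n}) a) hne => // [lt|gt] _; first by rewrite fa // mul0r.
rewrite (gb ((a + b)%MM - k)%MM) ?mulr0 // -(ltmc_add2r k).
by rewrite [(k + _)%MM]addmC submK ?ltmc_add2l //; apply/mnm_lepP.
Qed.

HB.instance Definition _ :=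
  GRing.ComUnitRing_isIntegral.Build (fps n R) fps_idomainP.

End FpsIdomain.

Section Order.
Context (n : nat) (R : comNzRingType).

Definition fps_has_degree (f : fps n R) (d : nat) : bool :=
  `[< exists2 u, mdeg u = d & fps_coef f u != 0 >].

(* Junk value 0 at f = 0. *)
Definition fps_order (f : fps n R) : nat :=
  if pselect (exists d, fps_has_degree f d) is left e then ex_minn e else 0%N.

Definition initial_form (f : fps n R) : {mpoly R[n]} :=
  \sum_(u : 'X_{1..n < (fps_order f).+1} | mdeg u == fps_order f)
     fps_coef f u *: 'X_[u].

End Order.

(* An element z of C[[X^(1/m), Y^(1/m)]] is encoded as an element of C[[x, y]]
   with x = X^(1/m) and y = Y^(1/m); the integer m is carried separately. *)
Definition exponents (n : nat) (R : comNzRingType) (z : fps n R) :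
    set 'X_{1..n} :=
  [set u | fps_coef z u != 0].

Definition puiseux_order (n : nat) (R : comNzRingType) (m : nat) (z : fps n R) :
    \bar rat :=
  if z == 0 then +oo%E else ((fps_order z)%:R / m%:R)%:E.

Section PowerSubst.
Context (n : nat) (R : comNzRingType) (m : nat).
Implicit Types f g : fps n R.

Definition mnm_dvd (u : 'X_{1..n}) : bool := [forall i, (m %| u i)%N].
Definition mnm_div (u : 'X_{1..n}) : 'X_{1..n} :=
  [multinom (u i %/ m)%N | i < n].

(* f(X_1, ..., X_n) |-> f(x_1^m, ..., x_n^m), that is, the inclusion of the
   power series in X_i = x_i^m into the power series in x_i *)
Definition fps_subst_pow f : fps n R := Fps (fun u =>
  if mnm_dvd u then fps_coef f (mnm_div u) else 0).

Context (m_gt0 : (0 < m)%N).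

Lemma mnm_divMn (u : 'X_{1..n}) (k : 'X_{1..n}) :
  ((k *+ m)%MM == u) = mnm_dvd u && (k == mnm_div u).
Proof.
apply/eqP/andP => [<-|[/forallP h /eqP ->]].
  split; first by apply/forallP => i; rewrite mulmnE dvdn_mull.
  by apply/eqP/mnmP => i; rewrite mnmE mulmnE mulnK.
by apply/mnmP => i; rewrite mulmnE mnmE divnK.
Qed.

Lemma mdeg_mnm_div u : (mdeg (mnm_div u) <= mdeg u)%N.
Proof. by rewrite !mdegE leq_sum // => i _; rewrite mnmE leq_div. Qed.

Let subst (p : {mpoly R[n]}) : {mpoly R[n]} :=
  p \mPo [tuple 'X_i ^+ m | i < n].

Lemma subst_coef p u : (subst p)@_u = if mnm_dvd u then p@_(mnm_div u) else 0.
Proof.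
have e (k : 'X_{1..n}) : \prod_(i < n) tnth [tuple ('X_i : {mpoly R[n]}) ^+ m | i < n] i ^+ k i
    = 'X_[(k *+ m)%MM].
  rewrite mpolyXE_id; apply: eq_bigr => i _.
  by rewrite tnth_mktuple mulmnE mulnC exprM.
rewrite /subst comp_mpolyE raddf_sum /=; under eq_bigr => k _.
  rewrite mcoeffZ e mcoeffX mnm_divMn; over.
case: ifP => hu /=; last by rewrite big1 // => k _; rewrite mulr0.
have [hs|hs] := boolP (mnm_div u \in msupp p).
  rewrite (bigD1_seq _ hs) //= eqxx mulr1 big1 ?addr0 // => k /negPf ->.
  by rewrite mulr0.
rewrite (memN_msupp_eq0 hs) big_seq big1 // => k hk.
by case: eqP => [ek|_]; rewrite ?mulr0 //; rewrite -ek hk in hs.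
Qed.

Fact fps_subst_pow_zmod_morphism : zmod_morphism fps_subst_pow.
Proof. by move=> f g; apply/fpsP => u /=; case: ifP; rewrite ?subr0. Qed.

Fact fps_subst_pow_monoid_morphism : monoid_morphism fps_subst_pow.
Proof.
split=> [|f g]; apply/fpsP => u /=.
  have -> : (u == 0%MM) = mnm_dvd u && (0%MM == mnm_div u).
    have e0 : (0 *+ m)%MM = 0%MM :> 'X_{1..n}.
      by apply/mnmP => i; rewrite mulmnE !mnm0E mul0n.
    by rewrite -mnm_divMn e0 eq_sym.
  by rewrite eq_sym; case: ifP.
have hu := ltnSn (mdeg u); set d := (mdeg u).+1 in hu.
have hT h v : (mdeg v < d)%N ->
    (subst (fps_trunc d h))@_v = fps_coef (fps_subst_pow h) v.
  move=> hv; rewrite subst_coef /=; case: ifP => // _.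
  by rewrite fps_trunc_coef // (leq_ltn_trans (mdeg_mnm_div v)).
change (fps_coef (fps_subst_pow (fps_mul f g)) u =
  fps_coef (fps_mul (fps_subst_pow f) (fps_subst_pow g)) u).
rewrite (fps_mulE hu (hT f) (hT g)) /subst -rmorphM subst_coef.
rewrite [LHS]/fps_coef /fps_subst_pow; case: ifP => // _.
by rewrite (fps_trunc_mul _ _ (leq_ltn_trans (mdeg_mnm_div u) hu)).
Qed.

Fact fps_subst_pow_inj : injective fps_subst_pow.
Proof.
move=> f g /fpsP h; apply/fpsP => k; move: (h (k *+ m)%MM) => /=.
by have := mnm_divMn (k *+ m) k; rewrite eqxx => /esym /andP[-> /eqP <-].
Qed.

End PowerSubst.

(* For an injective ring morphism phi this is the induced map a / b |->
   phi a / phi b on fraction fields, see frac_mapE below. *)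
Definition frac_map (A B : idomainType) (phi : A -> B) (x : {fraction A}) :
    {fraction B} :=
  FracField.tofrac (phi \n_(repr x)) / FracField.tofrac (phi \d_(repr x)).

Lemma fraction_repr (A : idomainType) (x : {fraction A}) :
  x = FracField.tofrac \n_(repr x) / FracField.tofrac \d_(repr x).
Proof.
have d0 := denom_ratioP (repr x).
apply/eqP; rewrite eq_sym -(inj_eq (mulIf (_ : FracField.tofrac \d_(repr x) != 0)));
  last by rewrite tofrac_eq0.
rewrite divfK ?tofrac_eq0 //; move: d0.
rewrite -{3}[x]reprK; move: (repr x) => r d0; unlock FracField.tofrac.
rewrite -[X in _ == X]FracField.pi_mul eqmodE /= FracField.equivfE /FracField.mulf.
by rewrite !numden_Ratio ?mulr1 ?mul1r ?oner_eq0 // mulrC.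
Qed.

Lemma frac_mapE (A B : idomainType) (phi : A -> B) (a b : A) :
    monoid_morphism phi -> zmod_morphism phi -> injective phi -> b != 0 ->
  frac_map phi (FracField.tofrac a / FracField.tofrac b)
    = FracField.tofrac (phi a) / FracField.tofrac (phi b).
Proof.
move=> [_ phiM] phiB phi_inj b0.
have phi0 : phi 0 = 0 by rewrite -[X in phi X](subrr 0) phiB subrr.
have phin0 c : c != 0 -> FracField.tofrac (phi c) != 0.
  by move=> c0; rewrite tofrac_eq0 -phi0 (inj_eq phi_inj).
have := fraction_repr (FracField.tofrac a / FracField.tofrac b).
rewrite /frac_map; move: (repr _) => r /eqP.
rewrite eqr_div ?tofrac_eq0 ?denom_ratioP // -!tofracM tofrac_eq => /eqP e.
apply/eqP; rewrite eqr_div ?phin0 ?denom_ratioP // -!tofracM tofrac_eq -!phiM.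
by rewrite e.
Qed.

Definition is_minpoly (K L : fieldType) (iota : K -> L) (z : L)
    (p : {poly K}) : Prop :=
  [/\ p \is monic, root (map_poly iota p) z &
      forall q : {poly K}, q != 0 -> root (map_poly iota q) z ->
        (size p <= size q)%N].

(* F, with coefficients in C[[X, Y]], is the minimal polynomial over
   C((X, Y)) of the Puiseux series z, which lives in C((x, y)). *)
Definition puiseux_minpoly (n : nat) (R : idomainType) (m : nat) (z : fps n R)
    (F : {poly fps n R}) : Prop :=
  is_minpoly (frac_map (@fps_subst_pow n R m)) (FracField.tofrac z)
    (map_poly (@FracField.tofrac (fps n R)) F).

(* The inclusion of R[[X_1, ..., X_n]][Z] into R[[X_1, ..., X_n, Z]]; the last
   variable is Z. *)
Definition fps_of_poly (n : nat) (R : comNzRingType) (F : {poly fps n R}) :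
    fps n.+1 R :=
  Fps (fun u => fps_coef F`_(u ord_max)
                  [multinom u (widen_ord (leqnSn n) i) | i < n]).

(* p is, up to a nonzero constant, a product of linear forms of which exactly r
   are pairwise non-proportional. *)
Definition has_distinct_linear_factors (n : nat) (K : fieldType)
    (p : {mpoly K[n]}) (r : nat) : Prop :=
  exists (c : K) (l : 'I_r -> {mpoly K[n]}) (e : 'I_r -> nat),
    [/\ c != 0,
        forall i, l i \is 1.-homog /\ l i != 0,
        forall i, (0 < e i)%N,
        forall i j, i != j -> forall a : K, l i != a *: l j &
        p = c *: \prod_(i < r) l i ^+ e i].

Definition prime_ideal (A : comNzRingType) (P : set A) : Prop :=
  idealr_closed (mem P) /\ prime_idealr_closed (mem P).

Definition ideal_power (A : comNzRingType) (P : set A) (r : nat) : set A :=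
  [set f | exists (k : nat) (a : 'I_k -> A) (p : 'I_k -> 'I_r -> A),
     (forall i j, P (p i j)) /\ f = \sum_(i < k) a i * \prod_(j < r) p i j].

(* The contraction to A of P^r A_P. *)
Definition symbolic_power (A : comNzRingType) (P : set A) (r : nat) : set A :=
  [set f | exists2 s, ~ P s & ideal_power P r (s * f)].

Definition prime_chain (A : comNzRingType) (P : set A) (h : nat) : Prop :=
  exists Q : 'I_h.+1 -> set A,
    [/\ forall i, prime_ideal (Q i),
        forall i j : 'I_h.+1, (i < j)%N -> Q i `<` Q j &
        Q ord_max = P].

Definition has_height (A : comNzRingType) (P : set A) (h : nat) : Prop :=
  prime_chain P h /\ forall k, prime_chain P k -> (k <= h)%N.

Section Hypersurface.
Context (A : comUnitRingType) (F : A) (F_nonunit : F \isn't a GRing.unit).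

(* The library's quotients are by proper ideals only, whence F_nonunit. *)
Definition principal_ideal of F \isn't a GRing.unit : {pred A} :=
  fun f => `[< exists g, f = g * F >].

Fact principal_ideal_closed : idealr_closed (principal_ideal F_nonunit).
Proof.
split.
- by apply/asboolP; exists 0; rewrite mul0r.
- apply/negP => /asboolP [g e]; move/negP: F_nonunit; apply.
  by apply/unitrPr; exists g; rewrite mulrC -e.
- move=> a u v /asboolP [g ->] /asboolP [h ->]; apply/asboolP.
  by exists (a * g + h); rewrite mulrDl mulrA.
Qed.

HB.instance Definition _ :=
  isIdealr.Build A (principal_ideal F_nonunit) principal_ideal_closed.

Definition hypersurface_ring : comNzRingType :=
  {ideal_quot (principal_ideal F_nonunit)}.

Definition hypersurface_proj (f : A) : hypersurface_ring :=
  \pi_{ideal_quot (principal_ideal F_nonunit)}%qT f.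

End Hypersurface.

(* The image of P in A / (F) has height h. *)
Definition has_height_mod (A : comUnitRingType) (F : A) (P : set A) (h : nat) :
    Prop :=
  exists F_nonunit : F \isn't a GRing.unit,
    has_height (hypersurface_proj F_nonunit @` P) h.

Definition equimultiple_locus (n : nat) (R : idomainType) (F : fps n R) :
    set (set (fps n R)) :=
  [set P | prime_ideal P /\ symbolic_power P (fps_order F) F].

(* (X_1, ..., X_n) *)
Definition closed_point (n : nat) (R : comNzRingType) : set (fps n R) :=
  [set f | exists a : 'I_n -> fps n R, f = \sum_(i < n) a i * fps_var R i].

Arguments closed_point n R : clear implicits.

(* Main.v *)
(* Take m = 4 and, writing x = X^(1/4), y = Y^(1/4), the series
   zeta_a = 2 x^2 + a x y + y^2 for a = 2 and a = 3.  It has eight conjugates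
   zeta_a(p x, q y), p^4 = q^4 = 1, whose product gives, with L = 4 X + Y,
   Q = Z^2 + L and c = 4 - a^2, the equation
     F_a = (Q^2 + c^2 X Y - 4 Z^2 L)^2 - X Y (2 c Q - 16 Z^2)^2
   of multiplicity 4 and initial form (L^2 - c^2 X Y)^2.  The initial form is
   L^4 for a = 2 and (16 X - Y)^2 (X - Y)^2 for a = 3.

   F_2 = Q^4 - 8 L Z^2 Q^2 + 16 (4 X - Y)^2 Z^4 lies in the fourth power of the
   ideal P of the curve Z = L = 0.  The image of P modulo F_2 has height 1:
   by Weierstrass division the quotient is integral over C[[X, Y]], so that
   comparable primes are separated by their traces on C[[X, Y]]; the trace of P
   is (L), and the only prime strictly inside (L) is 0.

   If F_3 lies in P^(4) then P contains all partial derivatives of F_3 of order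
   at most 3.  The third derivatives in X and Y are linear forms in X, Y, Z^2
   of rank 3, so P contains X, Y and Z. *)

Require Import Defs.
From mathcomp Require Import all_boot all_order all_algebra.
From mathcomp Require Import mpoly.
From mathcomp Require Import boolp classical_sets reals constructive_ereal.
From mathcomp Require Import complex.
From HB Require Import structures.
From mathcomp Require Import ring zify.

Set Implicit Arguments.
Unset Strict Implicit.
Unset Printing Implicit Defensive.

Import Order.TTheory GRing.Theory Num.Theory.

Local Open Scope ring_scope.
Local Open Scope classical_set_scope.

(** * Polynomial substitution in power series *)

Lemma mcoeffM_order (n : nat) (R : comNzRingType) (p q : {mpoly R[n]}) a b :
    (forall u, (mdeg u < a)%N -> p@_u = 0) ->
    (forall u, (mdeg u < b)%N -> q@_u = 0) ->
  forall u, (mdeg u < a + b)%N -> (p * q)@_u = 0.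
Proof.
move=> hp hq u hu; rewrite mcoeffM_lin big1 // => k hk.
case: (ltnP (mdeg k) a) => [/hp->|ha]; first by rewrite mul0r.
rewrite hq ?mulr0 //; have := mdegD (u - k) k; rewrite submK //.
by move: hu ha; lia.
Qed.

Lemma submBK (n : nat) (u v : 'X_{1..n}) : (v <= u)%MM -> (u - (u - v))%MM = v.
Proof. by move/mnm_lepP => h; apply/mnmP => i; rewrite !mnmBE subKn. Qed.

Section FpsOfMpoly.
Context (n : nat) (R : comNzRingType).
Implicit Types (f g : fps n R) (p q : {mpoly R[n]}).

Definition fps_of_mpoly p : fps n R := Fps (fun u => p@_u).

Fact fps_of_mpoly_zmod_morphism : zmod_morphism fps_of_mpoly.
Proof. by move=> p q; apply/fpsP => u /=; rewrite mcoeffB. Qed.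

Fact fps_of_mpoly_monoid_morphism : monoid_morphism fps_of_mpoly.
Proof.
split=> [|p q]; apply/fpsP => u /=; first by rewrite mcoeff1.
exact: mcoeffM_lin.
Qed.

HB.instance Definition _ := GRing.isZmodMorphism.Build {mpoly R[n]} (fps n R)
  fps_of_mpoly fps_of_mpoly_zmod_morphism.
HB.instance Definition _ := GRing.isMonoidMorphism.Build {mpoly R[n]} (fps n R)
  fps_of_mpoly fps_of_mpoly_monoid_morphism.

Lemma fps_coef_mpoly p u : fps_coef (fps_of_mpoly p) u = p@_u.
Proof. by []. Qed.

Lemma fps_coefD f g u : fps_coef (f + g) u = fps_coef f u + fps_coef g u.
Proof. by []. Qed.

Lemma fps_coefB f g u : fps_coef (f - g) u = fps_coef f u - fps_coef g u.
Proof. by []. Qed.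

Lemma fps_coef_sum (I : Type) (r : seq I) (P : pred I) (F : I -> fps n R) u :
  fps_coef (\sum_(i <- r | P i) F i) u = \sum_(i <- r | P i) fps_coef (F i) u.
Proof.
exact: (big_morph (fun f => fps_coef f u) (fun f g => fps_coefD f g u) erefl).
Qed.

Lemma fps_coefM f g u : fps_coef (f * g) u =
  \sum_(k : 'X_{1..n < (mdeg u).+1} | (k <= u)%MM)
     fps_coef f k * fps_coef g (u - k)%MM.
Proof. by []. Qed.

Lemma fps_coefM_trunc d f g u : (mdeg u < d)%N ->
  fps_coef (f * g) u = (fps_trunc d f * fps_trunc d g)@_u.
Proof. by move=> hu; rewrite (fps_trunc_mul _ _ hu). Qed.

Lemma fps_coef0M f g :
  fps_coef (f * g) 0%MM = fps_coef f 0%MM * fps_coef g 0%MM.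
Proof.
have h0 : (mdeg (0%MM : 'X_{1..n}) < 1)%N by rewrite mdeg0.
by rewrite (fps_coefM_trunc _ _ h0) rmorphM /= !fps_trunc_coef.
Qed.

(* [fps_of_mpoly 'X_[v]] is the monomial X^v *)
Lemma fps_coefMX f v u : fps_coef (f * fps_of_mpoly 'X_[v]) u =
  if (v <= u)%MM then fps_coef f (u - v)%MM else 0.
Proof.
rewrite fps_coefM; case: ifP => [hv|/negP hv].
  have hd : (mdeg (u - v) < (mdeg u).+1)%N by rewrite ltnS mdegB.
  rewrite (bigD1 (BMultinom hd)) /=; last by apply/mnm_lepP => i; rewrite mnmBE leq_subr.
  rewrite mcoeffX submBK // eqxx mulr1 big1 ?addr0 // => k /andP[hk].
  rewrite bmeqP /= => hne; rewrite mcoeffX; case: eqP => [e|_]; last by rewrite mulr0.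
  by rewrite e submBK // eqxx in hne.
rewrite big1 // => k hk; rewrite fps_coef_mpoly mcoeffX; case: eqP => [e|_]; last by rewrite mulr0.
by case: hv; rewrite e; apply/mnm_lepP => i; rewrite mnmBE leq_subr.
Qed.

Lemma fps_var_mpoly i : fps_var R i = fps_of_mpoly 'X_i.
Proof. by apply/fpsP => u /=; rewrite mcoeffX eq_sym. Qed.

End FpsOfMpoly.

(** [muni] reads a polynomial as univariate in its last variable, here $Z$, and [fps_of_poly] undoes
    this. Orders, initial forms and ideal membership of the surface can thus be computed on an
    explicit polynomial in three variables. *)
Lemma fps_of_muni (n : nat) (R : comNzRingType) (p : {mpoly R[n.+1]}) :
  fps_of_poly (map_poly (@fps_of_mpoly n R) (muni p)) = fps_of_mpoly p.
Proof.
apply/fpsP => u /=; rewrite coef_map /= muniE coef_sum raddf_sum /=.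
rewrite [RHS](congr1 (mcoeff u) (mpolyE p)).
rewrite raddf_sum /=; apply: eq_bigr => m _.
rewrite !coefZ coefXn -scalerAl mcoeffZ mcoeffZ mcoeffX; congr (_ * _).
have [->|ne] := eqVneq m u; first by rewrite eqxx mulr1 mcoeffX eqxx.
have [e|_] := eqVneq (u ord_max) (m ord_max); last by rewrite mulr0 mcoeff0.
rewrite mulr1 mcoeffX; case: eqP => // /mnmP e'; case/eqP: ne.
apply/mnmP => i; have [->//|im] := eqVneq i ord_max.
have hi : (i < n)%N.
  by rewrite ltn_neqAle -ltnS ltn_ord andbT; apply: contra im => /eqP ei; apply/eqP/val_inj.
have := e' (Ordinal hi); rewrite !mnmE.
by have -> : widen_ord (leqnSn n) (Ordinal hi) = i by apply/val_inj.
Qed.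

Section Substitution.
Context (n k : nat) (R : comNzRingType).

Record mpoly_subst := MpolySubst {
  subst_tuple :> n.-tuple {mpoly R[k]};
  subst_tuple0 : forall i, (tnth subst_tuple i)@_0%MM = 0
}.

(** The substituted polynomials have no constant term, so a monomial of degree above [mdeg v]
    contributes only terms of degree above [mdeg v]; the truncation determines the coefficient at
    [v]. *)
Definition fps_subst (s : mpoly_subst) (f : fps n R) : fps k R :=
  Fps (fun v => (fps_trunc (mdeg v).+1 f \mPo s)@_v).

Variable s : mpoly_subst.

Lemma subst_monomial_order (m : 'X_{1..n}) v :
  (mdeg v < mdeg m)%N -> ('X_[m] \mPo s)@_v = 0.
Proof.
rewrite comp_mpolyX (mdegE m).
elim: (index_enum 'I_n) v => [|i r ih] v; first by rewrite !big_nil.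
rewrite !big_cons; apply: mcoeffM_order => // {}v.
elim: (m i) v => [|d IH] v //; rewrite exprS -(add1n d).
apply: mcoeffM_order => // u; rewrite ltnS leqn0 mdeg_eq0 => /eqP->.
exact: subst_tuple0.
Qed.

(** Any polynomial agreeing with [f] below degree [d] may replace the truncation. One bound then
    serves many coefficients, and the ring laws are inherited from composition of polynomials. *)
Lemma fps_substE d (p : {mpoly R[n]}) (f : fps n R) v : (mdeg v < d)%N ->
    (forall u, (mdeg u < d)%N -> p@_u = fps_coef f u) ->
  fps_coef (fps_subst s f) v = (p \mPo s)@_v.
Proof.
move=> hd hp; apply/eqP; rewrite -subr_eq0 -mcoeffB -raddfB /=; apply/eqP.
rewrite comp_mpolyEX raddf_sum /= big1 // => m _.
rewrite mcoeffZ; case: (ltnP (mdeg v) (mdeg m)) => h.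
  by rewrite subst_monomial_order ?mulr0.
rewrite mcoeffB hp; last exact: leq_ltn_trans h hd.
by rewrite fps_trunc_coef ?subrr ?mul0r.
Qed.

Fact fps_subst_zmod_morphism : zmod_morphism (fps_subst s).
Proof.
move=> f g; apply/fpsP => v /=; rewrite -mcoeffB -raddfB /=.
congr (_ \mPo _)@__; apply/mpolyP => u; rewrite mcoeffB !fps_truncE.
by case: ifP; rewrite ?subr0.
Qed.

Fact fps_subst_monoid_morphism : monoid_morphism (fps_subst s).
Proof.
split=> [|f g]; apply/fpsP => v; have hv := ltnSn (mdeg v).
  by rewrite (@fps_substE _ 1 _ _ hv) ?rmorph1 /= ?mcoeff1 // => u _; rewrite mcoeff1.
rewrite (@fps_substE _ (fps_trunc (mdeg v).+1 f * fps_trunc (mdeg v).+1 g) _ _ hv).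
  rewrite rmorphM mcoeffM_lin fps_coefM; apply: eq_bigr => w hw.
  have hwd : (mdeg w < (mdeg v).+1)%N by case: (w).
  have hwd' : (mdeg (v - w) < (mdeg v).+1)%N by rewrite ltnS mdegB.
  by congr (_ * _); symmetry; (apply: fps_substE; [eassumption | move=> u; apply: fps_trunc_coef]).
by move=> u hu; rewrite -(fps_coefM_trunc _ _ hu).
Qed.

HB.instance Definition _ := GRing.isZmodMorphism.Build (fps n R) (fps k R)
  (fps_subst s) fps_subst_zmod_morphism.
HB.instance Definition _ := GRing.isMonoidMorphism.Build (fps n R) (fps k R)
  (fps_subst s) fps_subst_monoid_morphism.

Lemma fps_subst_mpoly p : fps_subst s (fps_of_mpoly p) = fps_of_mpoly (p \mPo s).
Proof. by apply/fpsP => v; apply: (@fps_substE (mdeg v).+1). Qed.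

End Substitution.

Lemma comp_mpolyA (R : comNzRingType) n k l (s : n.-tuple {mpoly R[k]})
    (t : k.-tuple {mpoly R[l]}) (w : n.-tuple {mpoly R[l]}) p :
  (forall i, tnth s i \mPo t = tnth w i) -> (p \mPo s) \mPo t = p \mPo w.
Proof.
move=> h; rewrite (comp_mpolyE p s) (comp_mpolyE p w) raddf_sum /=; apply: eq_bigr => m _.
rewrite comp_mpolyZ rmorph_prod /=; congr (_ *: _); apply: eq_bigr => i _.
by rewrite rmorphXn /= h.
Qed.

(** Equality of composite substitutions is reduced to one polynomial identity per variable. *)
Lemma fps_subst_comp (R : comNzRingType) n k l (s : mpoly_subst n k R)
    (t : mpoly_subst k l R) (w : mpoly_subst n l R) f :
  (forall i, tnth s i \mPo t = tnth w i) ->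
  fps_subst t (fps_subst s f) = fps_subst w f.
Proof.
move=> h; apply/fpsP => v; have hv := ltnSn (mdeg v).
rewrite (@fps_substE _ _ _ t _ (fps_trunc (mdeg v).+1 f \mPo s) _ _ hv).
  by rewrite (comp_mpolyA _ h).
move=> u hu; rewrite (@fps_substE _ _ _ s _ (fps_trunc (mdeg v).+1 f) _ _ hu) //.
by move=> x; apply: fps_trunc_coef.
Qed.

(** * Minimal polynomials from conjugates *)

(** The conjugations are defined on power series, not on fractions; clearing denominators makes them
    applicable to a competing polynomial. *)
Lemma fraction_poly_clear_denominators (A : idomainType)
    (q : {poly {fraction A}}) :
  exists2 d : A, d != 0 &
    exists2 Q : {poly A}, (size Q <= size q)%N &
      forall i, q`_i = FracField.tofrac Q`_i / FracField.tofrac d.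
Proof.
pose den i := \d_(repr q`_i); pose num i := \n_(repr q`_i).
have den0 i : den i != 0 by apply: denom_ratioP.
exists (\prod_(j < size q) den j); first by apply/prodf_neq0 => j _.
exists (\poly_(i < size q) (num i * \prod_(j < size q | (j != i :> nat)) den j)).
  exact: size_poly.
move=> i; rewrite coef_poly; case: ltnP => hi; last by rewrite nth_default // tofrac0 mul0r.
have h0 : FracField.tofrac (\prod_(j < size q) den j) != 0.
  by rewrite tofrac_eq0; apply/prodf_neq0 => j _.
rewrite {1}[q`_i]fraction_repr; apply/eqP; rewrite eqr_div ?tofrac_eq0 ?den0 //.
rewrite -!tofracM tofrac_eq (bigD1 (Ordinal hi)) //=.
  apply/eqP.
  by rewrite mulrCA mulrC -!mulrA.
by rewrite -tofrac_eq0.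
Qed.

(** The morphisms fix series in $X_i = x_i^m$, hence the coefficients of any polynomial over them,
    and carry its root [z] to all of [zs]. A nonzero polynomial killing [z] therefore has at least
    [size zs] roots, which is the degree of $F$. *)
Lemma puiseux_minpoly_of_conjugates (n : nat) (R : idomainType) (m : nat)
    (z : fps n R) (F : {poly fps n R}) (zs : seq (fps n R)) :
    (0 < m)%N ->
    map_poly (@fps_subst_pow n R m) F = \prod_(w <- zs) ('X - w%:P) ->
    z \in zs -> uniq zs ->
    (forall w, w \in zs -> exists2 s : {rmorphism fps n R -> fps n R},
       (forall f, s (fps_subst_pow m f) = fps_subst_pow m f) & s z = w) ->
  puiseux_minpoly m z F.
Proof.
move=> m0 hF hz huniq hconj.
have phiM := fps_subst_pow_monoid_morphism n R m0.
have phiB := @fps_subst_pow_zmod_morphism n R m.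
have phi_inj := @fps_subst_pow_inj n R m m0.
pose phi : {rmorphism fps n R -> fps n R} :=
  HB.pack (@fps_subst_pow n R m) (GRing.isZmodMorphism.Build _ _ _ phiB)
    (GRing.isMonoidMorphism.Build _ _ _ phiM).
pose iota := frac_map phi.
have iotaE a b : b != 0 -> iota (FracField.tofrac a / FracField.tofrac b) =
    FracField.tofrac (phi a) / FracField.tofrac (phi b) by apply: frac_mapE.
have iota_tofrac a : iota (FracField.tofrac a) = FracField.tofrac (phi a).
  have := iotaE a 1 (oner_neq0 _).
  by rewrite !rmorph1 !divr1.
have iota0 : iota 0 = 0 by rewrite -tofrac0 iota_tofrac rmorph0.
change (map_poly phi F = \prod_(w <- zs) ('X - w%:P)) in hF.
have sizeF : size F = (size zs).+1.
  by rewrite -(size_map_inj_poly phi_inj (rmorph0 phi)) hF size_prod_XsubC.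
have Fmonic : F \is monic.
  have := monic_prod_XsubC zs xpredT id; rewrite -hF !monicE.
  rewrite (lead_coef_map_inj phi_inj (rmorph0 phi)) => /eqP h.
  by apply/eqP/phi_inj; rewrite [LHS]h; exact: (esym (rmorph1 phi)).
split; first exact: monic_map.
  rewrite (_ : map_poly _ _ = map_poly (@FracField.tofrac _) (map_poly phi F)); last first.
    apply/polyP => i; rewrite coef_map_id0 // !coef_map /=; exact: iota_tofrac.
  rewrite hF /root horner_map tofrac_eq0 -[_ == 0]/(root _ _) root_prod_XsubC.
  exact: hz.
move=> q q0 hq; rewrite (size_map_poly_id0) ?tofrac_eq0; last first.
  by rewrite lead_coef_eq0 -size_poly_gt0 sizeF.
have [d d0 [Q sQ hQ]] := fraction_poly_clear_denominators q.
rewrite sizeF; apply: leq_trans sQ.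
have Q0 : Q != 0.
  apply: contra q0 => /eqP Q0; apply/eqP/polyP => i.
  by rewrite hQ Q0 coef0 tofrac0 mul0r coef0.
have hQz : root (map_poly phi Q) z.
  rewrite /root -tofrac_eq0 -horner_map /=.
  have -> : map_poly (@FracField.tofrac _) (map_poly phi Q)
      = FracField.tofrac (phi d) *: map_poly iota q.
    apply/polyP => i; rewrite coefZ !coef_map /= coef_map_id0 // hQ iotaE //.
    rewrite mulrCA divff ?mulr1 // tofrac_eq0 -(rmorph0 phi).
    by rewrite (inj_eq phi_inj).
  by rewrite hornerZ (eqP hq) mulr0.
rewrite -(size_map_inj_poly phi_inj (rmorph0 phi)).
apply: max_poly_roots => //.
  by rewrite -size_poly_eq0 (size_map_inj_poly phi_inj (rmorph0 phi)) size_poly_eq0.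
apply/allP => w /hconj [s sphi <-].
rewrite /root; have -> : map_poly phi Q = map_poly s (map_poly phi Q).
  by apply/polyP => i; rewrite !coef_map /= sphi.
by rewrite horner_map (eqP hQz) rmorph0.
Qed.

(** * The surfaces and their branches *)

(** This is $\zeta_a(p x, q y)$. Like [surface], it is written over any commutative ring, since it
    is needed for polynomials and for polynomials over power series, and morphisms carry it from one
    to the other. *)
Definition conjugate (B : comNzRingType) (a : nat) (p q x y : B) : B :=
  2 * (p * x) ^+ 2 + a%:R * (p * x) * (q * y) + (q * y) ^+ 2.

Definition surface (B : comNzRingType) (a : nat) (X Y Z : B) : B :=
  let Q := Z ^+ 2 + 4 * X + Y in let c := 4 - a%:R ^+ 2 in
  (Q ^+ 2 + c ^+ 2 * X * Y - 4 * Z ^+ 2 * (4 * X + Y)) ^+ 2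
  - X * Y * (2 * c * Q - 16 * Z ^+ 2) ^+ 2.

(** Representatives of the sixteen pairs of fourth roots of unity up to a common sign, which
    [conjugate] does not see. *)
Definition conj_pairs (B : comNzRingType) (j : B) : seq (B * B) :=
  [:: (1, 1); (1, -1); (j, 1); (j, -1); (1, j); (1, - j); (j, j); (j, - j)].

Lemma rmorph_surface (B B' : comNzRingType) (f : {rmorphism B -> B'}) a X Y Z :
  f (surface a X Y Z) = surface a (f X) (f Y) (f Z).
Proof.
by rewrite /surface /= !(rmorph_nat, rmorphXn, rmorphB, rmorphM, rmorphD).
Qed.

Lemma rmorph_conjugate (B B' : comNzRingType) (f : {rmorphism B -> B'}) a p q x y :
  f (conjugate a p q x y) = conjugate a (f p) (f q) (f x) (f y).
Proof. by rewrite /conjugate !(rmorph_nat, rmorphXn, rmorphM, rmorphD). Qed.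

Lemma map_conj_pairs (B B' : comNzRingType) (f : {rmorphism B -> B'}) j :
  conj_pairs (f j) = [seq (f p.1, f p.2) | p <- conj_pairs j].
Proof. by rewrite /conj_pairs /= !(rmorph1, rmorphN). Qed.

(* The eight factors multiply in pairs to G(e X^(1/2), d Y^(1/2)), where e, d
   are signs and G(s, t) = (Z - 2 s - t)^2 - a^2 s t. *)
Lemma surface_conjugates (B : comNzRingType) (a : nat) (j x y Z : B) :
    j ^+ 2 = -1 ->
  \prod_(p <- conj_pairs j) (Z - conjugate a p.1 p.2 x y) =
    surface a (x ^+ 4) (y ^+ 4) Z.
Proof.
move=> j2; rewrite !big_cons big_nil /= mulr1 /conjugate /surface.
rewrite !exprMn !j2 !sqrrN j2 !expr1n.
set s := x ^+ 2; set t := y ^+ 2; set b := a%:R.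
have -> : x ^+ 4 = s ^+ 2 by rewrite -exprM.
have -> : y ^+ 4 = t ^+ 2 by rewrite -exprM.
pose G s t := (Z - 2 * s - t) ^+ 2 - b ^+ 2 * s * t.
have e1 : (Z - (2 * (1 * s) + b * (1 * x) * (1 * y) + 1 * t)) *
   (Z - (2 * (1 * s) + b * (1 * x) * (-1 * y) + 1 * t)) = G s t.
  by rewrite /G /s /t; ring.
have e2 : (Z - (2 * (-1 * s) + b * (j * x) * (1 * y) + 1 * t)) *
   (Z - (2 * (-1 * s) + b * (j * x) * (-1 * y) + 1 * t)) = G (- s) t.
  by rewrite /G /s /t; ring: j2.
have e3 : (Z - (2 * (1 * s) + b * (1 * x) * (j * y) + -1 * t)) *
   (Z - (2 * (1 * s) + b * (1 * x) * (- j * y) + -1 * t)) = G s (- t).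
  by rewrite /G /s /t; ring: j2.
have e4 : (Z - (2 * (-1 * s) + b * (j * x) * (j * y) + -1 * t)) *
   (Z - (2 * (-1 * s) + b * (j * x) * (- j * y) + -1 * t)) = G (- s) (- t).
  by rewrite /G /s /t; ring: j2.
have pairs (u1 u2 u3 u4 u5 u6 u7 u8 : B) :
    u1 * (u2 * (u3 * (u4 * (u5 * (u6 * (u7 * u8)))))) =
    (u1 * u2) * ((u3 * u4) * ((u5 * u6) * (u7 * u8))) by rewrite !mulrA.
rewrite pairs e1 e2 e3 e4.
rewrite /G; ring.
Qed.

Notation X2 := ('X_(@Ordinal 2 0 isT)).
Notation Y2 := ('X_(@Ordinal 2 1 isT)).
Notation X3 := ('X_(@Ordinal 3 0 isT)).
Notation Y3 := ('X_(@Ordinal 3 1 isT)).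
Notation Z3 := ('X_(@Ordinal 3 2 isT)).

Lemma muni_var_max (n : nat) (R : comNzRingType) (i : 'I_n.+1) :
  i = n :> nat -> muni ('X_i : {mpoly R[n.+1]}) = 'X.
Proof.
move=> e; have {e}-> : i = ord_max by apply/val_inj.
rewrite muniE msuppX big_seq1 mcoeffX eqxx scale1r mnm1E eqxx expr1.
rewrite (_ : [multinom _ | _ < n] = 0%MM) ?mpolyX0 ?scale1r //.
apply/mnmP => k; rewrite mnmE mnm1E mnm0E; case: eqP => // /(congr1 val) /= e.
by have := ltn_ord k; rewrite -e ltnn.
Qed.

Lemma muni_var_widen (n : nat) (R : comNzRingType) (i : 'I_n.+1) (j : 'I_n) :
  i = j :> nat -> muni ('X_i : {mpoly R[n.+1]}) = ('X_j)%:P.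
Proof.
move=> e; have {e}-> : i = widen_ord (leqnSn n) j by apply/val_inj.
rewrite muniE msuppX big_seq1 mcoeffX eqxx scale1r mnm1E.
rewrite (_ : (_ == _) = false) ?expr0 -?mul_polyC ?mulr1; last first.
  by apply/eqP => /(congr1 val) /= e; have := ltn_ord j; rewrite e ltnn.
congr ('X_[_])%:P; apply/mnmP => k; rewrite mnmE !mnm1E.
by rewrite -!(inj_eq val_inj).
Qed.

Lemma comp_mpoly_var (n k : nat) (R : comNzRingType) (i : 'I_n)
  (s : n.-tuple {mpoly R[k]}) : 'X_i \mPo s = tnth s i.
Proof. by rewrite comp_mpolyXU -tnth_nth. Qed.

Fact pow_subst0 (n : nat) (R : comNzRingType) (m : nat) (m0 : (0 < m)%N) i :
  (tnth [tuple ('X_i ^+ m : {mpoly R[n]}) | i < n] i)@_0%MM = 0.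
Proof.
by rewrite tnth_mktuple mcoeffXn -mdeg_eq0 mdegMn mdeg1 mul1n eqn0Ngt m0.
Qed.

Definition pow_subst (n : nat) (R : comNzRingType) (m : nat) (m0 : (0 < m)%N) :=
  MpolySubst (@pow_subst0 n R m m0).

Lemma fps_subst_powE (n : nat) (R : comNzRingType) (m : nat) (m0 : (0 < m)%N) :
  @fps_subst_pow n R m = fps_subst (pow_subst n R m0).
Proof.
apply/funext => f; apply/fpsP => u /=.
rewrite (subst_coef m0); case: ifP => // _; rewrite fps_trunc_coef // ltnS.
exact: mdeg_mnm_div.
Qed.

Fact scale_subst0 (n : nat) (R : comNzRingType) (c : 'I_n -> R) i :
  (tnth [tuple (c i *: 'X_i : {mpoly R[n]}) | i < n] i)@_0%MM = 0.
Proof. by rewrite tnth_mktuple mcoeffZ mcoeffX mnm1_eq0 mulr0. Qed.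

Definition scale_subst (n : nat) (R : comNzRingType) (c : 'I_n -> R) :=
  MpolySubst (scale_subst0 c).

(** $(c_i x_i)^m = x_i^m$: rescaling by roots of unity is a conjugation over the series in the
    $X_i$. *)
Lemma scale_pow_subst (n : nat) (R : comNzRingType) (m : nat) (c : 'I_n -> R) f :
    (0 < m)%N -> (forall i, c i ^+ m = 1) ->
  fps_subst (scale_subst c) (fps_subst_pow m f) = fps_subst_pow m f.
Proof.
move=> m0 hc; rewrite (fps_subst_powE n R m0); apply: fps_subst_comp => i /=.
rewrite !tnth_mktuple rmorphXn /= comp_mpoly_var tnth_mktuple exprZn hc.
by rewrite scale1r.
Qed.

(** * The minimal polynomial of $\zeta_a$ *)

Section Surface.
Context (C : numClosedFieldType) (a : nat).

Definition surface_mpoly : {mpoly C[3]} := surface a X3 Y3 Z3.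

Definition surface_poly : {poly fps 2 C} :=
  map_poly (@fps_of_mpoly 2 C) (muni surface_mpoly).

Lemma fps_of_surface_poly :
  fps_of_poly surface_poly = fps_of_mpoly surface_mpoly.
Proof. exact: fps_of_muni. Qed.

Definition branch_mpoly (p q : C) : {mpoly C[2]} :=
  conjugate a p%:MP q%:MP X2 Y2.

Definition branch : fps 2 C := fps_of_mpoly (branch_mpoly 1 1).

Lemma mcoeff_branch p q u : (branch_mpoly p q)@_u =
  2 * p ^+ 2 * (U_(@Ordinal 2 0 isT) *+ 2 == u)%MM%:R
  + a%:R * p * q * (U_(@Ordinal 2 0 isT) + U_(@Ordinal 2 1 isT) == u)%MM%:R
  + q ^+ 2 * (U_(@Ordinal 2 1 isT) *+ 2 == u)%MM%:R.
Proof.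
rewrite /branch_mpoly /conjugate.
rewrite (_ : _ + _ = (2 * p ^+ 2) *: X2 ^+ 2 + (a%:R * p * q) *: (X2 * Y2)
   + (q ^+ 2) *: Y2 ^+ 2); last first.
  rewrite -!mul_mpolyC !(rmorph_nat, rmorphXn, rmorphM) /=; ring.
by rewrite !mcoeffD !mcoeffZ !mcoeffXn -mpolyXD mcoeffX.
Qed.

Lemma branch_triple p q (b := branch_mpoly p q) :
  (b@_(U_(@Ordinal 2 0 isT) *+ 2)%MM,
   b@_(U_(@Ordinal 2 0 isT) + U_(@Ordinal 2 1 isT))%MM,
   b@_(U_(@Ordinal 2 1 isT) *+ 2)%MM) = (2 * p ^+ 2, a%:R * p * q, q ^+ 2).
Proof.
rewrite /b !mcoeff_branch.
have e1 : (U_(@Ordinal 2 0 isT) *+ 2 ==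
           U_(@Ordinal 2 0 isT) + U_(@Ordinal 2 1 isT))%MM = false.
  by apply/eqP => /mnmP /(_ (@Ordinal 2 0 isT)); rewrite mnmDE mulmnE !mnm1E.
have e2 : (U_(@Ordinal 2 1 isT) *+ 2 ==
           U_(@Ordinal 2 0 isT) + U_(@Ordinal 2 1 isT))%MM = false.
  by apply/eqP => /mnmP /(_ (@Ordinal 2 0 isT)); rewrite mnmDE mulmnE !mnm1E.
have e3 : (U_(@Ordinal 2 0 isT) *+ 2 == U_(@Ordinal 2 1 isT) *+ 2 :> 'X_{1..2})%MM = false.
  by apply/eqP => /mnmP /(_ (@Ordinal 2 0 isT)); rewrite !mulmnE !mnm1E.
have e1' := e1; rewrite eq_sym in e1'.
have e2' := e2; rewrite eq_sym in e2'.
have e3' := e3; rewrite eq_sym in e3'.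
rewrite !eqxx e1 e2 e3 e1' e2' e3'.
by rewrite !mulr0 !mulr1 !addr0 !add0r.
Qed.

Lemma fps_subst_branch p q :
  fps_subst (scale_subst (fun i : 'I_2 => if i == 0 :> nat then p else q)) branch
    = fps_of_mpoly (branch_mpoly p q).
Proof.
rewrite fps_subst_mpoly; congr fps_of_mpoly.
rewrite /branch_mpoly rmorph_conjugate /= !rmorph1 !comp_mpoly_var.
rewrite !tnth_mktuple /= -!mul_mpolyC /conjugate.
by rewrite !mul1r.
Qed.

(** After $X = x^4$, $Y = y^4$ this is [surface_conjugates] in [{poly fps 2 C}], where the root of
    $-1$ is the constant ['i] transported by [kappa]. *)
Lemma surface_poly_conjugates :
  map_poly (@fps_subst_pow 2 C 4) surface_poly =
  \prod_(w <- [seq fps_of_mpoly (branch_mpoly p.1 p.2) | p <- conj_pairs 'i])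
     ('X - w%:P).
Proof.
have m0 : (0 < 4)%N by [].
rewrite (fps_subst_powE 2 C m0) /surface_poly /surface_mpoly.
set rhs := RHS; rewrite !rmorph_surface /=.
rewrite (@muni_var_widen _ _ _ (@Ordinal 2 0 isT)) //.
rewrite (@muni_var_widen _ _ _ (@Ordinal 2 1 isT)) // muni_var_max //.
rewrite !(map_polyC (@fps_of_mpoly 2 C)) !map_polyX.
rewrite !(map_polyC (fps_subst (pow_subst 2 C m0))) /= !fps_subst_mpoly !comp_mpoly_var.
rewrite !tnth_mktuple !rmorphXn /rhs {rhs}.
pose kappa : {rmorphism C -> {poly fps 2 C}} :=
  [the {rmorphism C -> {poly fps 2 C}} of
     polyC \o (@fps_of_mpoly 2 C \o @mpolyC 2 C)].
rewrite -(@surface_conjugates _ a (kappa 'i)); last by rewrite -rmorphXn sqrCi rmorphN1.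
rewrite map_conj_pairs [RHS]big_map big_map; apply: eq_bigr => -[p q] _.
by rewrite /branch_mpoly !rmorph_conjugate.
Qed.

Lemma conj_pairs_uniq : (0 < a)%N ->
  uniq [seq fps_of_mpoly (branch_mpoly p.1 p.2) | p <- conj_pairs ('i : C)].
Proof.
move=> a0.
(* Dividing the coefficients of $x^2$ and $x y$ by 2 and $a$ leaves $(p^2, p q, q^2)$, which
   determines $(p, q)$ up to a common sign and so separates the eight pairs. *)
pose T (f : fps 2 C) :=
  (fps_coef f (U_(@Ordinal 2 0 isT) *+ 2)%MM / 2,
   fps_coef f (U_(@Ordinal 2 0 isT) + U_(@Ordinal 2 1 isT))%MM / a%:R,
   fps_coef f (U_(@Ordinal 2 1 isT) *+ 2)%MM).
have TE p q : T (fps_of_mpoly (branch_mpoly p q)) = (p ^+ 2, p * q, q ^+ 2).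
  have [e1 e2 e3] := branch_triple p q.
  rewrite /T !fps_coef_mpoly e1 e2 e3.
  have h2 : (2 : C) != 0 by rewrite pnatr_eq0.
  have ha : (a%:R : C) != 0 by rewrite pnatr_eq0 -lt0n.
  by congr (_, _, _); field.
apply: (@map_uniq _ _ T); rewrite -map_comp.
rewrite (@eq_map _ _ _ (fun p => (p.1 ^+ 2, p.1 * p.2, p.2 ^+ 2))); last first.
  by move=> p; apply: TE.
rewrite /conj_pairs /=.
have n1 : ((1 : C) == -1) = false.
  by rewrite -subr_eq0 opprK -[1 + 1]/(2%:R) pnatr_eq0.
have ni : (('i : C) == - 'i) = false.
  rewrite -subr_eq0 opprK -mulr2n -mulr_natl mulf_eq0 pnatr_eq0 /=.
  by rewrite (negPf (neq0Ci _)).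
have n1' : ((-1 : C) == 1) = false by rewrite eq_sym.
rewrite !inE !xpair_eqE !sqrrN !sqrCi !expr1n !mul1r !mulr1 !mulrN !mulr1.
rewrite -!expr2 !sqrCi !opprK !eqxx ?n1 ?n1' ?ni //=.
by rewrite ?(andbT, andbF, orbF, n1, n1', ni, eqxx).
Qed.

Lemma branch_minpoly : (0 < a)%N -> puiseux_minpoly 4 branch surface_poly.
Proof.
move=> a0; apply: puiseux_minpoly_of_conjugates (surface_poly_conjugates) _ _ _ => //.
- by rewrite /conj_pairs /= inE eqxx.
- exact: conj_pairs_uniq.
move=> w /mapP [[p q] hpq ->].
exists (fps_subst (scale_subst (fun i : 'I_2 => if i == 0 :> nat then p else q))).
  move=> f; apply: scale_pow_subst => // i.
  have : (p ^+ 4 = 1) /\ (q ^+ 4 = 1).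
    have i4 : ('i : C) ^+ 4 = 1 by rewrite (exprM _ 2 2) sqrCi sqrrN expr1n.
    have n4 (x : C) : (- x) ^+ 4 = x ^+ 4 by rewrite !(exprM _ 2 2) sqrrN.
    move: hpq; rewrite !inE !xpair_eqE.
    by do ![case/orP => [/andP[/eqP-> /eqP->]|]]; rewrite ?n4 ?i4 ?expr1n //
      => /andP[/eqP-> /eqP->]; rewrite ?n4 ?i4 ?expr1n.
  by case=> ? ?; case: ifP.
exact: fps_subst_branch.
Qed.

End Surface.

(** * Initial forms *)

(** A bound on the order that, unlike [fps_order], has no exceptional value at 0. *)
Definition mpoly_order_ge (n : nat) (R : comNzRingType) (d : nat)
    (p : {mpoly R[n]}) : Prop :=
  forall u, (mdeg u < d)%N -> p@_u = 0.

Section OrderGe.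
Context (n : nat) (R : comNzRingType).
Implicit Types p q : {mpoly R[n]}.

Lemma order_ge_add d p q : mpoly_order_ge d p -> mpoly_order_ge d q ->
  mpoly_order_ge d (p + q).
Proof. by move=> hp hq u hu; rewrite mcoeffD hp ?hq ?addr0. Qed.

Lemma order_ge_sub d p q : mpoly_order_ge d p -> mpoly_order_ge d q ->
  mpoly_order_ge d (p - q).
Proof. by move=> hp hq u hu; rewrite mcoeffB hp ?hq ?subr0. Qed.

Lemma order_ge_mul d e p q : mpoly_order_ge d p -> mpoly_order_ge e q ->
  mpoly_order_ge (d + e) (p * q).
Proof. exact: mcoeffM_order. Qed.

Lemma order_ge_mulr d p q : mpoly_order_ge d q -> mpoly_order_ge d (p * q).
Proof. by move=> hq; rewrite -[d]add0n; apply: order_ge_mul. Qed.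

Lemma order_ge_sqr d p : mpoly_order_ge d p -> mpoly_order_ge (d + d) (p ^+ 2).
Proof. by move=> hp; rewrite expr2; apply: order_ge_mul. Qed.

Lemma order_ge_le d e p : (d <= e)%N -> mpoly_order_ge e p -> mpoly_order_ge d p.
Proof. by move=> de hp u hu; apply: hp; apply: leq_trans hu de. Qed.

Lemma order_ge_var i : mpoly_order_ge 1 ('X_i : {mpoly R[n]}).
Proof.
by move=> u; rewrite ltnS leqn0 mdeg_eq0 => /eqP ->; rewrite mcoeffX mnm1_eq0.
Qed.

Lemma fps_orderE (f : fps n R) d u :
    (forall v, (mdeg v < d)%N -> fps_coef f v = 0) ->
    mdeg u = d -> fps_coef f u != 0 ->
  fps_order f = d.
Proof.
move=> hlt hd hu; rewrite /fps_order; case: pselect => [e|[]]; last first.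
  by exists d; apply/asboolP; exists u.
case: ex_minnP => e' /asboolP [v hv fv] hmin; apply/eqP; rewrite eqn_leq.
rewrite hmin /=; last by apply/asboolP; exists u.
by rewrite leqNgt -hv; apply: contra fv => /hlt ->.
Qed.

Lemma initial_form_homog_add d p q : p \is d.-homog -> p != 0 ->
    mpoly_order_ge d.+1 q ->
  fps_order (fps_of_mpoly (p + q)) = d /\
  initial_form (fps_of_mpoly (p + q)) = p.
Proof.
move=> hp p0 hq.
have coef u : (mdeg u <= d)%N -> (p + q)@_u = p@_u.
  by move=> hu; rewrite mcoeffD hq ?addr0.
have order : fps_order (fps_of_mpoly (p + q)) = d.
  have pm : mlead p \in msupp p by rewrite mlead_supp.
  have dm := dhomog_mf hp pm.
  apply: (@fps_orderE _ _ (mlead p)) => //.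
    move=> v hv; rewrite fps_coef_mpoly coef ?(ltnW hv) //.
    by apply: (dhomog_nemf_coeff hp); rewrite neq_ltn hv.
  by rewrite fps_coef_mpoly coef ?dm // -mcoeff_msupp.
split=> //; rewrite /initial_form order; apply/mpolyP => v.
rewrite raddf_sum /=; case: (eqVneq (mdeg v) d) => hv.
  have hv' : (mdeg v < d.+1)%N by rewrite hv.
  rewrite (bigD1 (BMultinom hv')) /=; last by apply/eqP.
  rewrite mcoeffZ mcoeffX eqxx mulr1 coef ?hv // big1 ?addr0 // => w /andP[_].
  rewrite bmeqP /= => hw; rewrite mcoeffZ mcoeffX (negPf hw) mulr0 //.
rewrite (dhomog_nemf_coeff hp hv) big1 // => w /eqP hw.
rewrite mcoeffZ mcoeffX; case: eqP => [e|]; rewrite ?mulr0 //.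
by rewrite -e hw eqxx in hv.
Qed.

End OrderGe.

(** * Tangent cones and exponents in the family $\zeta_a$ *)

Section SurfaceInitialForm.
Context (C : numClosedFieldType) (a : nat).

Definition tangent_cone : {mpoly C[3]} :=
  ((4 * X3 + Y3) ^+ 2 - (4 - a%:R ^+ 2) ^+ 2 * X3 * Y3) ^+ 2.

(** At $Z = 0$ the equation becomes $(L^2 + c^2 X Y)^2 - 4 c^2 X Y L^2 = (L^2 - c^2 X Y)^2$; all
    other terms have degree at least 5. *)
Lemma surface_tangent_cone :
  exists2 h, mpoly_order_ge 5 h & surface_mpoly C a = tangent_cone + h.
Proof.
set L : {mpoly C[3]} := 4 * X3 + Y3.
set c : {mpoly C[3]} := 4 - a%:R ^+ 2.
(* Each square in [surface] minus its value at $Z = 0$ is a difference of squares divisible by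
   $Z^2$; the combined cofactor has order at least 3. *)
exists (Z3 ^+ 2 * ((Z3 ^+ 2 - 2 * L) *
   ((Z3 ^+ 2 + L) ^+ 2 + L ^+ 2 + 2 * c ^+ 2 * (X3 * Y3) - 4 * L * Z3 ^+ 2)
   - X3 * Y3 * ((2 * c - 16) * (2 * c * (Z3 ^+ 2 + 2 * L) - 16 * Z3 ^+ 2)))).
  have hX : mpoly_order_ge 1 (X3 : {mpoly C[3]}) by apply: order_ge_var.
  have hY : mpoly_order_ge 1 (Y3 : {mpoly C[3]}) by apply: order_ge_var.
  have hZ : mpoly_order_ge 1 (Z3 : {mpoly C[3]}) by apply: order_ge_var.
  have hZ2 := order_ge_sqr hZ.
  have hZ1 : mpoly_order_ge 1 ((Z3 : {mpoly C[3]}) ^+ 2) by apply: order_ge_le hZ2.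
  have hL : mpoly_order_ge 1 L by apply: order_ge_add => //; apply: order_ge_mulr.
  have hXY := order_ge_mul hX hY.
  apply: (@order_ge_mul _ _ 2 3) => //; apply: order_ge_sub.
    apply: (@order_ge_mul _ _ 1 2).
      by apply: order_ge_sub => //; apply: order_ge_mulr.
    apply: order_ge_sub; last exact: order_ge_mulr.
    apply: order_ge_add; last exact: order_ge_mulr.
    apply: order_ge_add; last exact: (@order_ge_sqr _ _ 1).
    by apply: (@order_ge_sqr _ _ 1); apply: order_ge_add.
  apply: (@order_ge_mul _ _ 2 1) => //; apply: order_ge_mulr.
  apply: order_ge_sub; last exact: order_ge_mulr.
  by apply: order_ge_mulr; apply: order_ge_add => //; apply: order_ge_mulr.
by rewrite /surface_mpoly /surface /tangent_cone -/L -/c -[_ + 4 * X3 + Y3]addrA -/L; ring.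
Qed.

Lemma dhomog_natr n k : (k%:R : {mpoly C[n]}) \is 0.-homog.
Proof. by apply: rpredMn; apply: dhomog1. Qed.

Lemma dhomog_var n (i : 'I_n) : ('X_i : {mpoly C[n]}) \is 1.-homog.
Proof. by rewrite dhomogX; apply/eqP; apply: mdeg1. Qed.

Lemma tangent_cone_homog : tangent_cone \is 4.-homog.
Proof.
have hX : (X3 : {mpoly C[3]}) \is 1.-homog := dhomog_var _.
have hY : (Y3 : {mpoly C[3]}) \is 1.-homog := dhomog_var _.
apply: (@dhomogMn _ _ _ 2 _ 2); apply: rpredB.
  apply: (@dhomogMn _ _ _ 1 _ 2); apply: rpredD => //.
  by apply: (@dhomogM _ _ _ 0 _ 1) => //; apply: dhomog_natr.
apply: (@dhomogM _ _ _ 1 _ 1) => //; apply: (@dhomogM _ _ _ 0 _ 1) => //.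
apply: (@dhomogMn _ _ _ 0 _ 2); apply: rpredB; first exact: dhomog_natr.
by apply: (@dhomogMn _ _ _ 0 _ 2); apply: dhomog_natr.
Qed.

Lemma tangent_cone_neq0 : tangent_cone != 0.
Proof.
(* At the point $(1, 0, 0)$ the form takes the value $4^4$. *)
apply/negP => /eqP /(congr1 (meval (fun i : 'I_3 => (i == 0 :> nat)%:R))).
rewrite rmorph0 /tangent_cone !(rmorph_nat, rmorphXn, rmorphB, rmorphM, rmorphD) /=.
rewrite !mevalXU /= !mulr0 addr0 subr0 mulr1 => /eqP.
by rewrite !expf_eq0 /= pnatr_eq0.
Qed.

Lemma surface_order : fps_order (fps_of_mpoly (surface_mpoly C a)) = 4%N.
Proof.
have [h hh ->] := surface_tangent_cone.
by have [] := initial_form_homog_add tangent_cone_homog tangent_cone_neq0 hh.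
Qed.

Lemma surface_initial_form :
  initial_form (fps_of_mpoly (surface_mpoly C a)) = tangent_cone.
Proof.
have [h hh ->] := surface_tangent_cone.
by have [] := initial_form_homog_add tangent_cone_homog tangent_cone_neq0 hh.
Qed.

Definition branch_exponents : seq 'X_{1..2} :=
  [:: U_(@Ordinal 2 0 isT) *+ 2; U_(@Ordinal 2 0 isT) + U_(@Ordinal 2 1 isT);
      U_(@Ordinal 2 1 isT) *+ 2]%MM.

(** The coefficients of $x^2$, $x y$, $y^2$ are 2, $a$, 1, all nonzero for positive $a$, so the set
    of exponents does not depend on $a$. *)
Lemma exponents_branch : (0 < a)%N ->
  exponents (branch C a) = [set u | u \in branch_exponents].
Proof.
move=> a0; apply/seteqP; split=> u /=.
  apply: contraNT => hu; move: hu.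
  rewrite fps_coef_mpoly mcoeff_branch !inE ![u == _]eq_sym !negb_or.
  by case/and3P=> /negPf-> /negPf-> /negPf->; rewrite !mulr0 !addr0.
have [e1 e2 e3] := branch_triple a (1 : C) 1.
rewrite !inE /branch => /or3P[] /eqP ->; rewrite /exponents /=.
- by rewrite e1 expr1n mulr1 pnatr_eq0.
- by rewrite e2 !mulr1 pnatr_eq0 -lt0n.
- by rewrite e3 expr1n oner_eq0.
Qed.

Lemma branch_exponents_not_dvd :
  [set u | u \in branch_exponents] `&`
    [set u : 'X_{1..2} | forall i, (4 %| u i)%N] = set0.
Proof.
apply/seteqP; split=> // u [] /= + h; rewrite !inE.
move: (h (@Ordinal 2 0 isT)) (h (@Ordinal 2 1 isT)) => h0 h1.
by case/or3P => /eqP e; move: h0 h1; rewrite e ?mulmnE ?mnmDE !mnm1E.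
Qed.

(** The series is homogeneous of degree 2 in $x$ and $y$, each of order $1/4$. *)
Lemma branch_puiseux_order :
  puiseux_order 4 (branch C a) = ((2%:R / 4%:R)%:E : \bar rat)%E.
Proof.
have [_ _ e3] := branch_triple a (1 : C) 1.
have b0 : branch_mpoly a (1 : C) 1 != 0.
  apply/eqP => b0; move: e3; rewrite b0 mcoeff0 expr1n => /eqP.
  by rewrite eq_sym oner_eq0.
have bhom : branch_mpoly a (1 : C) 1 \is 2.-homog.
  have hX : ((X2 : {mpoly C[2]}) \is 1.-homog) := dhomog_var _.
  have hY : ((Y2 : {mpoly C[2]}) \is 1.-homog) := dhomog_var _.
  rewrite /branch_mpoly /conjugate mpolyC1 !mul1r.
  apply: rpredD; last exact: (@dhomogMn _ _ _ 1 _ 2).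
  apply: rpredD.
    by apply: (@dhomogM _ _ _ 0 _ 2); [exact: dhomog_natr|exact: (@dhomogMn _ _ _ 1 _ 2)].
  by apply: (@dhomogM _ _ _ 1 _ 1) => //; apply: (@dhomogM _ _ _ 0 _ 1) => //; exact: dhomog_natr.
have z0 : branch C a != 0.
  apply/eqP => /fpsP /(_ (U_(@Ordinal 2 1 isT) *+ 2)%MM).
  by rewrite fps_coef_mpoly e3 expr1n => /eqP; rewrite oner_eq0.
rewrite /puiseux_order (negPf z0) /branch.
have [] := initial_form_homog_add bhom b0 (_ : mpoly_order_ge 3 0).
  by move=> u _; rewrite mcoeff0.
by rewrite addr0 => ->.
Qed.

End SurfaceInitialForm.

Lemma linear_form_proportional (C : fieldType) (p q p' q' : C) (k : C) :
  p%:MP_[3] * X3 + q%:MP * Y3 = k *: (p'%:MP * X3 + q'%:MP * Y3) ->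
  p = k * p' /\ q = k * q'.
Proof.
move=> e; split; [move: (congr1 (mcoeff U_(@Ordinal 3 0 isT)%MM) e)|
  move: (congr1 (mcoeff U_(@Ordinal 3 1 isT)%MM) e)];
rewrite mcoeffZ !mcoeffD !mcoeffCM !mcoeffXU -!(inj_eq val_inj) /=;
by rewrite ?mulr1 ?mulr0 ?addr0 ?add0r.
Qed.

(** Proportional forms would have a vanishing determinant $p_i q_j - p_j q_i$; the condition on the
    [q i] keeps each form nonzero. *)
Lemma distinct_linear_factors (C : fieldType) (r : nat) (p q : 'I_r -> C)
    (e : 'I_r -> nat) :
    (forall i, q i != 0) -> (forall i, (0 < e i)%N) ->
    (forall i j, i != j -> p i * q j != p j * q i) ->
  has_distinct_linear_factors
    (\prod_(i < r) ((p i)%:MP_[3] * X3 + (q i)%:MP * Y3) ^+ e i) r.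
Proof.
move=> q0 e0 hpq.
exists 1, (fun i => (p i)%:MP_[3] * X3 + (q i)%:MP * Y3), e; split=> //.
- exact: oner_neq0.
- move=> i; split.
    by apply: rpredD; rewrite mul_mpolyC; apply: dhomogZ; rewrite dhomogX; apply/eqP; apply: mdeg1.
  apply/eqP => h; have : (p i)%:MP_[3] * X3 + (q i)%:MP * Y3 =
    0 *: ((p i)%:MP_[3] * X3 + (q i)%:MP * Y3) by rewrite h scaler0.
  case/linear_form_proportional => _; rewrite mul0r => /eqP.
  by rewrite (negPf (q0 i)).
- move=> i j ij k; apply/eqP => /linear_form_proportional [hp hq].
  by move/eqP: (hpq _ _ ij); apply; rewrite hp hq; ring.
by rewrite scale1r.
Qed.

(** For $a = 2$ the constant $c$ vanishes and $L^4$ remains. *)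
Lemma tangent_cone2_factors (C : numClosedFieldType) :
  has_distinct_linear_factors (tangent_cone C 2) 1.
Proof.
have := @distinct_linear_factors C 1 (fun=> 4) (fun=> 1) (fun=> 4%N).
rewrite big_ord1; rewrite (_ : _ ^+ 4 = tangent_cone C 2).
  apply => //= [i|i j]; first exact: oner_neq0.
  by rewrite (ord1 i) (ord1 j) eqxx.
by rewrite /tangent_cone !(rmorph_nat, rmorph1); ring.
Qed.

(** For $a = 3$, $c = -5$ and $L^2 - 25 X Y = 16 X^2 - 17 X Y + Y^2 = (16 X - Y)(X - Y)$. *)
Lemma tangent_cone3_factors (C : numClosedFieldType) :
  has_distinct_linear_factors (tangent_cone C 3) 2.
Proof.
have := @distinct_linear_factors C 2 (fun i => if i == 0 :> nat then 16 else 1)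
  (fun=> -1) (fun=> 2%N).
rewrite big_ord_recl big_ord1 /=.
rewrite (_ : _ * _ = tangent_cone C 3).
  apply => //= [i|i j]; first by rewrite oppr_eq0 oner_eq0.
  have h : (16 * -1 : C) != 1 * -1.
    by rewrite !mulrN1 eqr_opp (eqr_nat C 16 1).
  move=> ij; case: (@eqP _ (i : nat) 0%N) => hi; case: (@eqP _ (j : nat) 0%N) => hj //; last first.
  - have h1 (k : 'I_2) : k <> 0 :> nat -> k = 1 :> nat.
      by move: (ltn_ord k); lia.
    by rewrite -(inj_eq val_inj) /= (h1 _ hi) (h1 _ hj) eqxx in ij.
  - by rewrite eq_sym.
  by rewrite -(inj_eq val_inj) /= hi hj eqxx in ij.
by rewrite /tangent_cone !(rmorph_nat, rmorph1, rmorphN1); ring.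
Qed.

(** * Derivatives and symbolic powers *)

Section Derivation.
Context (n : nat) (R : comNzRingType).
Implicit Types f g : fps n R.

Definition fps_deriv (i : 'I_n) f : fps n R :=
  Fps (fun u => fps_coef f (u + U_(i))%MM *+ (u i).+1).

Lemma fps_derivD i f g : fps_deriv i (f + g) = fps_deriv i f + fps_deriv i g.
Proof. by apply/fpsP => u /=; rewrite mulrnDl. Qed.

Lemma fps_deriv_mpoly i p :
  fps_deriv i (fps_of_mpoly p) = fps_of_mpoly (p^`M(i)).
Proof. by apply/fpsP => u /=; rewrite mcoeff_deriv. Qed.

Lemma fps_derivM i f g :
  fps_deriv i (f * g) = fps_deriv i f * g + f * fps_deriv i g.
Proof.
apply/fpsP => u; rewrite fps_coefD.
change (fps_coef (fps_deriv i (f * g)) u) with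
  (fps_coef (f * g) (u + U_(i))%MM *+ (u i).+1).
(* Differentiation lowers the degree by one, so the truncations keep one degree more than the
   coefficient at [u] would require. *)
set d := (mdeg u).+2.
have hd : (mdeg (u + U_(i)) < d)%N by rewrite mdegD mdeg1 addn1.
rewrite (fps_coefM_trunc _ _ hd) -mcoeff_deriv mderivM mcoeffD.
have hu : (mdeg u < (mdeg u).+1)%N by [].
have hD h v : (mdeg v < (mdeg u).+1)%N ->
    (fps_trunc d h)^`M(i)@_v = fps_coef (fps_deriv i h) v.
  by move=> hv; rewrite mcoeff_deriv fps_trunc_coef // mdegD mdeg1 addn1.
have hT (h : fps n R) v : (mdeg v < (mdeg u).+1)%N -> (fps_trunc d h)@_v = fps_coef h v.
  by move=> hv; rewrite fps_trunc_coef // (leq_trans hv).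
by rewrite -(fps_mulE hu (hD f) (hT g)) -(fps_mulE hu (hT f) (hD g)).
Qed.

End Derivation.

Section PrimeIdeal.
Context (A : comNzRingType) (P : set A).
Hypothesis Pprime : prime_ideal P.

Lemma prime_ideal0 : P 0.
Proof. by case: Pprime => -[]; rewrite inE. Qed.

Lemma prime_ideal1 : ~ P 1.
Proof. by case: Pprime => -[_ h _] _ p1; move/negP: h; apply; rewrite inE. Qed.

Lemma prime_ideal_lin a f g : P f -> P g -> P (a * f + g).
Proof.
case: Pprime => -[_ _ h] _ pf pg.
by have := h a f g; rewrite !inE; apply.
Qed.

Lemma prime_idealD f g : P f -> P g -> P (f + g).
Proof. by move=> pf; rewrite -[f]mul1r; apply: prime_ideal_lin. Qed.

Lemma prime_idealM a f : P f -> P (a * f).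
Proof.
by move=> pf; rewrite -[a * f]addr0; apply: prime_ideal_lin => //; apply: prime_ideal0.
Qed.

Lemma prime_idealB f g : P f -> P g -> P (f - g).
Proof.
by move=> pf pg; apply: prime_idealD => //; rewrite -mulN1r; apply: prime_idealM.
Qed.

Lemma prime_ideal_prod f g : P (f * g) -> P f \/ P g.
Proof.
case: Pprime => _ h pfg; have := h f g; rewrite !inE => /(_ pfg) /orP[].
  by rewrite inE; left.
by rewrite inE; right.
Qed.

End PrimeIdeal.

Lemma prime_idealI (A : comNzRingType) (P : set A) :
    P 0 -> ~ P 1 -> (forall a f g, P f -> P g -> P (a * f + g)) ->
    (forall f g, P (f * g) -> P f \/ P g) ->
  prime_ideal P.
Proof.
move=> h0 h1 hl hp; split.
  split; [by rewrite inE | by apply/negP; rewrite inE | move=> a f g].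
  by rewrite !inE; apply: hl.
by move=> f g; rewrite !inE => /hp [h|h]; apply/orP; rewrite !inE; [left|right].
Qed.

Section SymbolicPowerDerivatives.
Context (n : nat) (R : comNzRingType) (P : set (fps n R)).
Hypothesis Pprime : prime_ideal P.
Implicit Types f g : fps n R.

(** The differential counterpart of the symbolic power: [f] and its iterated partial derivatives of
    order below [r] lie in [P]. The recursive form suits inductions by the Leibniz rule. *)
Fixpoint vanishes_to_order (r : nat) (f : fps n R) : Prop :=
  if r is r'.+1 then P f /\ forall i, vanishes_to_order r' (fps_deriv i f)
  else True.

Lemma vanishes_le r f : vanishes_to_order r.+1 f -> vanishes_to_order r f.
Proof. by elim: r f => // r ih f /= [pf h]; split=> // i; apply: ih; apply: h. Qed.

Lemma vanishesD r f g : vanishes_to_order r f -> vanishes_to_order r g ->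
  vanishes_to_order r (f + g).
Proof.
elim: r f g => // r ih f g /= [pf hf] [pg hg]; split; first exact: (prime_idealD Pprime).
by move=> i; rewrite fps_derivD; apply: ih.
Qed.

Lemma vanishesM r a f : vanishes_to_order r f -> vanishes_to_order r (a * f).
Proof.
elim: r a f => // r ih a f hf; move: (hf) => [pf hd].
split=> [|i]; first exact: (prime_idealM Pprime).
rewrite fps_derivM; apply: vanishesD; last exact: ih (hd i).
by apply: ih; apply: vanishes_le.
Qed.

(** By the Leibniz rule a derivative of $p f$ is $(\partial_i p) f + p\,\partial_i f$: the first
    term keeps the order of $f$, and in the second the factor $p$ makes up for the order lost, by
    induction. *)
Lemma vanishesMP r p f : P p -> vanishes_to_order r f ->
  vanishes_to_order r.+1 (p * f).
Proof.
elim: r f => [|r ih] f pp hf.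
  by split=> //; rewrite mulrC; apply: (prime_idealM Pprime).
have [pf hd] := hf; split=> [|i]; first exact: (prime_idealM Pprime).
rewrite fps_derivM; apply: vanishesD; first exact: vanishesM.
exact: ih pp (hd i).
Qed.

Lemma ideal_power_vanishes r f : ideal_power P r f -> vanishes_to_order r f.
Proof.
case=> k [a] [p] [hp ->]; elim/big_rec: _ => [|i g _ hg].
  elim: (r) => // d ih; split=> [|i]; first exact: (prime_ideal0 Pprime); rewrite (_ : fps_deriv i 0 = 0) //.
  by apply/fpsP => u; apply: mul0rn.
apply: vanishesD => //; apply: vanishesM.
elim: r p hp {hg} => // r ih p hp; rewrite big_ord_recl.
by apply: vanishesMP => //; exact: (ih (fun i j => p i (lift ord0 j))).
Qed.

(** By induction $f$ already vanishes to one order less, so $s\,\partial_i f = \partial_i(s f) -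
    (\partial_i s) f$ passes the hypothesis on to the derivatives; primality removes $s$ from $s f$
    itself. *)
Lemma vanishes_cancel r s f : ~ P s -> vanishes_to_order r (s * f) ->
  vanishes_to_order r f.
Proof.
move=> ns; elim: r f => // r ih f hsf; have [psf hd] := hsf.
have hf : vanishes_to_order r f := ih _ (vanishes_le hsf).
split=> [|i]; first by case: (prime_ideal_prod Pprime psf).
apply: ih; have := hd i; rewrite fps_derivM => h.
rewrite -[s * _](addKr (fps_deriv i s * f)) addrC; apply: vanishesD => //.
by rewrite -mulN1r; apply: vanishesM; apply: vanishesM.
Qed.

(** This necessary condition bounds the equimultiple locus of $F_3$ from above. *)
Lemma symbolic_power_vanishes r f : symbolic_power P r f -> vanishes_to_order r f.
Proof. by case=> s ns /ideal_power_vanishes; apply: vanishes_cancel. Qed.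

End SymbolicPowerDerivatives.

(** * Equimultiple loci *)

(** A list of coefficients, each with [r] factors from [P], serves as a certificate of membership;
    the explicit decompositions of $F_2$ and $F_3$ are given in this form. *)
Lemma ideal_power_seq (A : comNzRingType) (P : set A) r (ts : seq (A * seq A)) :
    (forall t, t \in ts -> size t.2 = r /\ forall p, p \in t.2 -> P p) ->
  ideal_power P r (\sum_(t <- ts) t.1 * \prod_(p <- t.2) p).
Proof.
move=> h; exists (size ts), (fun i => (nth (0, [::]) ts i).1),
  (fun i j => nth 0 (nth (0, [::]) ts i).2 j); split.
  move=> i j; have [e hp] := h _ (mem_nth (0, [::]) (ltn_ord i)).
  by apply: hp; rewrite mem_nth // e.
rewrite (big_nth (0, [::])) big_mkord; apply: eq_bigr => i _.
have [e _] := h _ (mem_nth (0, [::]) (ltn_ord i)).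
by rewrite (big_nth 0) big_mkord e.
Qed.

Lemma prime_ideal_symbolic_power (A : comNzRingType) (P : set A) r f :
  prime_ideal P -> ideal_power P r f -> symbolic_power P r f.
Proof.
move=> [[_ h _] _] hf; exists 1; last by rewrite mul1r.
by move=> p1; move/negP: h; apply; rewrite inE.
Qed.

Section ClosedPoint.
Context (n : nat) (R : idomainType).
Implicit Types f : fps n R.

Lemma closed_pointE f : closed_point n R f <-> fps_coef f 0%MM = 0.
Proof.
have u0 (u : 'X_{1..n}) (i : 'I_n) : (U_(i) <= u)%MM = (0 < u i)%N.
  apply/mnm_lepP/idP => [/(_ i)|h j]; rewrite mnm1E ?eqxx //.
  by case: eqP => [<-|].
split=> [[a ->]|f0].
  rewrite fps_coef_sum big1 // => i _.
  by rewrite fps_var_mpoly fps_coefMX u0 mnm0E.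
(* each monomial is attributed to the first variable which divides it *)
pose first (i : 'I_n) (u : 'X_{1..n}) := [forall k : 'I_n, (k < i)%N ==> (u k == 0)].
exists (fun i : 'I_n => Fps (fun v => if first i v then fps_coef f (v + U_(i))%MM else 0)).
apply/fpsP => u; rewrite fps_coef_sum.
under eq_bigr => i _ do rewrite fps_var_mpoly fps_coefMX u0 /=.
have firstE i : (0 < u i)%N -> first i (u - U_(i))%MM = first i u.
  move=> ui; apply: eq_forallb => k; case: ltnP => //= ki.
  rewrite mnmBE mnm1E; case: (eqVneq i k) => [e|_]; last by rewrite subn0.
  by rewrite -e ltnn in ki.
have [-> | un0] := eqVneq u 0%MM.
  by rewrite big1 // => i _; rewrite mnm0E.
have [i0 hi0] : exists i, (0 < u i)%N.
  apply: contrapT => h; case/eqP: un0; apply/mnmP => i; rewrite mnm0E.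
  by apply/eqP; rewrite -leqn0 leqNgt; apply/negP => hi; apply: h; exists i.
case: (@arg_minnP _ i0 (fun i => 0 < u i)%N (fun i => i : nat) hi0) => i ui hmin.
rewrite (bigD1 i) //= ui firstE // (_ : first i u); last first.
  apply/forallP => k; apply/implyP => ki; rewrite -leqn0 leqNgt.
  by apply/negP => /hmin; rewrite leqNgt ki.
rewrite big1 ?addr0; last first.
  move=> j ji; case: ifP => // uj; rewrite firstE //.
  case: ifP => // /forallP /(_ i) /implyP h; have := hmin _ uj.
  rewrite leq_eqVlt => /orP[/eqP e|/h]; last by rewrite eqn0Ngt ui.
  by case/eqP: ji; apply/val_inj.
by rewrite submK //; apply/mnm_lepP => k; rewrite mnm1E; case: eqP => [<-|].
Qed.

Lemma closed_point_prime : prime_ideal (closed_point n R).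
Proof.
split.
- split; rewrite ?inE.
  + exact/closed_pointE.
  + apply/negP; rewrite inE => /closed_pointE /= /eqP; rewrite eqxx; apply/negP.
    exact: oner_neq0.
  + move=> a f g; rewrite !inE => /closed_pointE hf /closed_pointE hg.
    by apply/closed_pointE; rewrite fps_coefD fps_coef0M hf hg mulr0 addr0.
move=> f g; rewrite !inE => /closed_pointE; rewrite fps_coef0M => /eqP.
rewrite mulf_eq0 => /orP[] /eqP h; apply/orP; [left|right].
  by rewrite inE; apply/closed_pointE.
by rewrite inE; apply/closed_pointE.
Qed.

Lemma closed_point_mpoly (p : {mpoly R[n]}) :
  p@_0%MM = 0 -> closed_point n R (fps_of_mpoly p).
Proof. by move=> h; apply/closed_pointE. Qed.

End ClosedPoint.

Lemma prime_ideal_const (n : nat) (C : fieldType) (P : set (fps n C)) (c : C) f :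
  prime_ideal P -> c != 0 -> P (fps_of_mpoly c%:MP * f) -> P f.
Proof.
move=> hP c0 /(prime_idealM hP (fps_of_mpoly c^-1%:MP)).
by rewrite mulrA -rmorphM -mpolyCM mulVf // mpolyC1 rmorph1 mul1r.
Qed.

(** If some [f] in [P] had constant term $c \neq 0$, then $c = f - (f - c)$ would lie in [P],
    although $c$ is a unit. *)
Lemma closed_point_maximal (n : nat) (C : fieldType) (P : set (fps n C)) :
  prime_ideal P -> (forall i, P (fps_var C i)) -> P = closed_point n C.
Proof.
move=> hP hv; have sub f : closed_point n C f -> P f.
  case=> a ->; elim/big_rec: _ => [|i g _ hg].
    by case: hP => -[]; rewrite inE.
  by apply: prime_ideal_lin.
apply/seteqP; split=> // f hf; apply/closed_pointE/eqP/negPn/negP => c0.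
set c := fps_coef f 0%MM in c0.
have h : P (fps_of_mpoly c%:MP * 1).
  rewrite mulr1 -[fps_of_mpoly _](subKr f); apply: prime_idealB => //.
  by apply/sub/closed_pointE; rewrite fps_coefB fps_coef_mpoly mcoeffC eqxx mulr1 subrr.
have := prime_ideal_const hP c0 h; case: hP => -[_ h1 _] _ p1.
by move/negP: h1; apply; rewrite inE.
Qed.

(** * The third derivatives of $F_3$ *)

Section ThirdDerivatives.
Context (C : numClosedFieldType).

(** A term is encoded by its integer coefficient and exponents, so that derivatives are computed on
    lists and [ring] only has to compare the results. *)
Definition mono (t : int * (nat * nat * nat)) : {mpoly C[3]} :=
  let: (k, (a, b, c)) := t in k%:~R * (X3 ^+ a * Y3 ^+ b * Z3 ^+ c).

Definition int_mono (k : int) (a b c : nat) : int * (nat * nat * nat) :=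
  (k, (a, b, c)).

Definition mono_sum (ts : seq (int * (nat * nat * nat))) : {mpoly C[3]} :=
  \sum_(t <- ts) mono t.

Definition mono_derivX (t : int * (nat * nat * nat)) :=
  let: (k, (a, b, c)) := t in (k * a%:Z, (a.-1, b, c)).

Definition mono_derivY (t : int * (nat * nat * nat)) :=
  let: (k, (a, b, c)) := t in (k * b%:Z, (a, b.-1, c)).

Lemma mderivXn (n : nat) (i j : 'I_n) k :
  ('X_i ^+ k : {mpoly C[n]})^`M(j) = (k * (i == j))%:R * 'X_i ^+ k.-1.
Proof.
elim: k => [|k ih]; first by rewrite mul0n mul0r expr0 -mpolyC1 mderivC.
rewrite exprS mderivM ih mderivX mnm1E /=; case: eqP => [->|_]; last first.
  by rewrite !muln0 scale0r !mul0r mulr0 addr0.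
rewrite !muln1 scale1r (_ : (U_(j) - U_(j))%MM = 0%MM) ?mpolyX0 ?mul1r; last first.
  by apply/mnmP => l; rewrite mnmBE subnn mnm0E.
case: k {ih} => [|k] /=; first by rewrite mul0r mulr0 addr0 expr0 mul1r.
by rewrite exprS -[in RHS]natr1; ring.
Qed.

Lemma mderiv_intr (n : nat) (j : 'I_n) (k : int) :
  (k%:~R : {mpoly C[n]})^`M(j) = 0.
Proof. by rewrite -(rmorph_int (@mpolyC n C)) mderivC. Qed.

Lemma mono_sum_derivX ts :
  (mono_sum ts)^`M(@Ordinal 3 0 isT) = mono_sum [seq mono_derivX t | t <- ts].
Proof.
rewrite /mono_sum big_map raddf_sum; apply: eq_bigr => -[k [[a b] c]] _ /=.
rewrite !mderivM !mderivXn mderiv_intr -!(inj_eq val_inj) /= !muln0 muln1 intrM.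
by rewrite -pmulrn; ring.
Qed.

Lemma mono_sum_derivY ts :
  (mono_sum ts)^`M(@Ordinal 3 1 isT) = mono_sum [seq mono_derivY t | t <- ts].
Proof.
rewrite /mono_sum big_map raddf_sum; apply: eq_bigr => -[k [[a b] c]] _ /=.
rewrite !mderivM !mderivXn mderiv_intr -!(inj_eq val_inj) /= !muln0 muln1 intrM.
by rewrite -pmulrn; ring.
Qed.

Definition surface3_monomials : seq (int * (nat * nat * nat)) :=
  [:: int_mono (256)%Z 4 0 0; int_mono (-544)%Z 3 1 0; int_mono (321)%Z 2 2 0; int_mono (-34)%Z 1 3 0;
      int_mono (1)%Z 0 4 0; int_mono (-256)%Z 3 0 2; int_mono (-2672)%Z 2 1 2; int_mono (-668)%Z 1 2 2;
      int_mono (-4)%Z 0 3 2; int_mono (96)%Z 2 0 4; int_mono (-578)%Z 1 1 4; int_mono (6)%Z 0 2 4;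
      int_mono (-16)%Z 1 0 6; int_mono (-4)%Z 0 1 6; int_mono (1)%Z 0 0 8].

Lemma surface3E : surface_mpoly C 3 = mono_sum surface3_monomials.
Proof.
rewrite /surface_mpoly /surface /mono_sum /surface3_monomials !big_cons big_nil /=.
ring.
Qed.

Lemma surface3_derivXXX :
  (surface_mpoly C 3)^`M(@Ordinal 3 0 isT)^`M(@Ordinal 3 0 isT)^`M(@Ordinal 3 0 isT)
  = 192 * (32 * X3 - 17 * Y3 - 8 * Z3 ^+ 2).
Proof.
rewrite surface3E !mono_sum_derivX /mono_sum !big_cons big_nil.
cbn [int_mono mono mono_derivX Nat.pred]; ring.
Qed.

Lemma surface3_derivXYY :
  (surface_mpoly C 3)^`M(@Ordinal 3 0 isT)^`M(@Ordinal 3 1 isT)^`M(@Ordinal 3 1 isT)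
  = 4 * (321 * X3 - 51 * Y3 - 334 * Z3 ^+ 2).
Proof.
rewrite surface3E mono_sum_derivX !mono_sum_derivY /mono_sum !big_cons big_nil.
cbn [int_mono mono mono_derivX mono_derivY Nat.pred]; ring.
Qed.

Lemma surface3_derivYYY :
  (surface_mpoly C 3)^`M(@Ordinal 3 1 isT)^`M(@Ordinal 3 1 isT)^`M(@Ordinal 3 1 isT)
  = 12 * (2 * Y3 - 17 * X3 - 2 * Z3 ^+ 2).
Proof.
rewrite surface3E !mono_sum_derivY /mono_sum !big_cons big_nil.
cbn [int_mono mono mono_derivY Nat.pred]; ring.
Qed.

End ThirdDerivatives.

(** * The equations $F_3$ and $F_2$ in fourth powers of primes *)

Section EquimultipleLocus.
Context (C : numClosedFieldType).
Local Notation F a := (fps_of_mpoly (surface_mpoly C a)).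

(** Three of the third derivatives are independent combinations of $X$, $Y$, $Z^2$, so [P] contains
    these, and then $Z$ by primality. *)
Lemma surface3_locus_vars (P : set (fps 3 C)) :
  prime_ideal P -> vanishes_to_order P 4 (F 3) -> forall i, P (fps_var C i).
Proof.
move=> hP hF.
have nat_unit k f : P (fps_of_mpoly k.+1%:R * f) -> P f.
  rewrite -(rmorph_nat (@mpolyC 3 C)); apply: prime_ideal_const => //.
  by rewrite pnatr_eq0.
have d3 i j k : P (fps_of_mpoly ((surface_mpoly C 3)^`M(i)^`M(j)^`M(k))).
  by case: hF => _ /(_ i) [_ /(_ j) [_ /(_ k) []]]; rewrite !fps_deriv_mpoly.
pose O := @Ordinal 3 0 isT; pose I := @Ordinal 3 1 isT.
have {nat_unit}nat_unit k (p q : {mpoly C[3]}) :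
    P (fps_of_mpoly q) -> q = k.+1%:R * p -> P (fps_of_mpoly p).
  by move=> hq e; apply: (nat_unit k); rewrite -rmorphM -e.
(* The constant factors 192, 4 and 12 are cancelled; [nat_unit] takes their predecessors. *)
have h1 := nat_unit 191%N _ _ (d3 O O O) (surface3_derivXXX C).
have h2 := nat_unit 3%N _ _ (d3 O I I) (surface3_derivXYY C).
have h3 := nat_unit 11%N _ _ (d3 I I I) (surface3_derivYYY C).
have lin p q r k : P (fps_of_mpoly p) -> P (fps_of_mpoly q) -> P (fps_of_mpoly r) ->
    forall a b c s, a * p + b * q + c * r = k.+1%:R * s -> P (fps_of_mpoly s).
  move=> hp hq hr a b c s; apply: nat_unit; rewrite !rmorphD !rmorphM.
  by do 2?apply: prime_idealD => //; apply: prime_idealM.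
(* The multipliers here and in the next two steps are, up to scaling, the rows of the inverse of the
   coefficient matrix of the three forms. *)
have hX : P (fps_of_mpoly X3).
  by apply: (lin _ _ _ 8099%N h1 h2 h3 (- 77) 5 (- 527)); ring.
have hY : P (fps_of_mpoly Y3).
  by apply: (lin _ _ _ 2024%N h1 h2 h3 (- 158) 5 (- 203)); ring.
have hZ : P (fps_of_mpoly (Z3 ^+ 2)).
  by apply: (lin _ _ _ 359%N h1 h2 h3 1 (- 1) (- 17)); ring.
have {}hZ : P (fps_of_mpoly Z3).
  by move: hZ; rewrite rmorphXn => /(prime_ideal_prod hP) [].
move=> [[|[|[|//]]] hi]; rewrite fps_var_mpoly.
- by rewrite (_ : Ordinal hi = O) //; apply/val_inj.
- by rewrite (_ : Ordinal hi = I) //; apply/val_inj.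
- by rewrite (_ : Ordinal hi = @Ordinal 3 2 isT) //; apply/val_inj.
Qed.

Definition quadric : {mpoly C[3]} := Z3 ^+ 2 + 4 * X3 + Y3.

Lemma surface3_closed_point : ideal_power (closed_point 3 C) 4 (F 3).
Proof.
pose L : {mpoly C[3]} := 4 * X3 + Y3; pose B := 5 * quadric + 8 * Z3 ^+ 2.
(* With $c = -5$ the first six entries expand $(Q^2 + 25 X Y - 4 Z^2 L)^2$, and the last is $-4 X Y
   B^2$, because $2 c Q - 16 Z^2 = -2 B$. *)
pose ts : seq ({mpoly C[3]} * seq {mpoly C[3]}) :=
  [:: (1, [:: quadric; quadric; quadric; quadric]); (16 * Z3 ^+ 2, [:: Z3; Z3; L; L]);
      (625, [:: X3; X3; Y3; Y3]); (- 8 * L, [:: quadric; quadric; Z3; Z3]);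
      (50, [:: quadric; quadric; X3; Y3]); (- 200 * L, [:: Z3; Z3; X3; Y3]);
      (- 4, [:: X3; Y3; B; B])].
have -> : surface_mpoly C 3 = \sum_(t <- ts) t.1 * \prod_(p <- t.2) p.
  rewrite /ts !(big_cons, big_nil) /B /L /quadric /surface_mpoly /surface /=; ring.
have hv i : ('X_i : {mpoly C[3]})@_0%MM = 0 by rewrite mcoeffX mnm1_eq0.
have h0 : {morph (mcoeff 0%MM : {mpoly C[3]} -> C) : p q / p * q} by exact: rmorphM.
have hL : L@_0%MM = 0 by rewrite mcoeffD h0 !hv mulr0 addr0.
have hQ : quadric@_0%MM = 0 by rewrite !mcoeffD expr2 !h0 !hv !mulr0 !addr0.
have hB : B@_0%MM = 0 by rewrite mcoeffD expr2 !h0 hQ !hv !mulr0 !addr0.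
rewrite rmorph_sum (_ : \sum_(t <- ts) _ = \sum_(t <- [seq (fps_of_mpoly t.1,
  [seq fps_of_mpoly p | p <- t.2]) | t <- ts]) t.1 * \prod_(p <- t.2) p); last first.
  by rewrite big_map; apply: eq_bigr => t _; rewrite rmorphM rmorph_prod big_map.
apply: ideal_power_seq => _ /mapP [t ht ->] /=; rewrite size_map.
have /andP[/eqP -> h] : (size t.2 == 4) && all (fun p => p@_0%MM == 0) t.2.
  by move: t ht; apply/allP; rewrite /ts /= !hv hL hQ hB eqxx.
by split=> // _ /mapP [p hp ->]; apply: closed_point_mpoly; apply/eqP/(allP h).
Qed.

Lemma surface3_equimultiple_locus :
  equimultiple_locus (F 3) = [set closed_point 3 C].
Proof.
rewrite /equimultiple_locus surface_order; apply/seteqP; split=> P /=.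
  case=> hP /(symbolic_power_vanishes hP) h.
  by apply: closed_point_maximal => // i; apply: surface3_locus_vars.
move=> ->; have hP := closed_point_prime 3 C; split=> //.
by apply: prime_ideal_symbolic_power => //; exact: surface3_closed_point.
Qed.

Lemma surface2_ideal_power (P : set (fps 3 C)) :
    P (fps_of_mpoly Z3) -> P (fps_of_mpoly quadric) -> ideal_power P 4 (F 2).
Proof.
move=> hZ hQ.
(* With $c = 0$ the equation is $(Q^2 - 4 Z^2 L)^2 - 256 X Y Z^4$, and $L^2 - 16 X Y = (4 X -
   Y)^2$. *)
pose ts : seq ({mpoly C[3]} * seq {mpoly C[3]}) :=
  [:: (1, [:: quadric; quadric; quadric; quadric]); (- 8 * (4 * X3 + Y3), [:: Z3; Z3; quadric; quadric]);
      (16 * (4 * X3 - Y3) ^+ 2, [:: Z3; Z3; Z3; Z3])].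
have -> : surface_mpoly C 2 = \sum_(t <- ts) t.1 * \prod_(p <- t.2) p.
  rewrite /ts !(big_cons, big_nil) /quadric /surface_mpoly /surface /=; ring.
rewrite rmorph_sum (_ : \sum_(t <- ts) _ = \sum_(t <- [seq (fps_of_mpoly t.1,
  [seq fps_of_mpoly p | p <- t.2]) | t <- ts]) t.1 * \prod_(p <- t.2) p); last first.
  by rewrite big_map; apply: eq_bigr => t _; rewrite rmorphM rmorph_prod big_map.
apply: ideal_power_seq => _ /mapP [t ht ->] /=; rewrite size_map.
have /andP[/eqP -> h] : (size t.2 == 4) && all (fun p => (p == Z3) || (p == quadric)) t.2.
  by move: t ht; apply/allP; rewrite /ts /= !eqxx !orbT.
by split=> // _ /mapP [p hp ->]; case/orP: (allP h _ hp) => /eqP ->.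
Qed.

End EquimultipleLocus.

(** * Weierstrass division *)

Section Weierstrass.
Context (n : nat) (R : comNzRingType).
Implicit Types (u v : 'X_{1..n.+1}) (f g : fps n.+1 R).

Definition mnm_restr u : 'X_{1..n} :=
  [multinom u (widen_ord (leqnSn n) i) | i < n].

Lemma mnm_restrD u v : mnm_restr (u + v) = (mnm_restr u + mnm_restr v)%MM.
Proof. by apply/mnmP => i; rewrite mnmDE !mnmE. Qed.

Lemma mnm_restr_max k : mnm_restr (U_(ord_max) *+ k) = 0%MM.
Proof.
apply/mnmP => i; rewrite mnmE mulmnE mnm1E mnm0E; case: eqP => // /(congr1 val) /= e.
by have := ltn_ord i; rewrite -e ltnn.
Qed.

Lemma mnm_restrK u : (mnmwiden (mnm_restr u) + U_(ord_max) *+ u ord_max)%MM = u.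
Proof.
apply/mnmP => i; rewrite mnmDE mulmnE mnm1E; have [<-|im] := eqVneq ord_max i.
  by rewrite mnmwiden_ordmax mul1n.
have hi : (i < n)%N.
  rewrite ltn_neqAle -ltnS ltn_ord andbT; apply: contra im => /eqP e.
  by rewrite eq_sym; apply/eqP/val_inj.
have -> : i = widen_ord (leqnSn n) (Ordinal hi) by apply/val_inj.
by rewrite mnmwiden_widen mnmE mul0n addn0.
Qed.

Fact widen_subst0 i :
  (tnth [tuple ('X_(widen_ord (leqnSn n) i) : {mpoly R[n.+1]}) | i < n] i)@_0%MM = 0.
Proof. by rewrite tnth_mktuple mcoeffX mnm1_eq0. Qed.

(** The inclusion of the series in the first [n] variables, written as a substitution so that it
    inherits the morphism structure and the composition lemma. *)
Definition widen_subst := MpolySubst widen_subst0.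

Lemma comp_widen_mwiden (p : {mpoly R[n]}) : p \mPo widen_subst = mwiden p.
Proof.
rewrite /mwiden comp_mpolyE; apply: eq_bigr => m _; rewrite -mul_mpolyC.
by congr (_ * _); apply: eq_bigr => i _; rewrite tnth_mktuple.
Qed.

Lemma fps_widen_coef (f : fps n R) u : fps_coef (fps_subst widen_subst f) u =
  if u ord_max == 0%N then fps_coef f (mnm_restr u) else 0.
Proof.
rewrite (@fps_substE _ _ _ _ _ (fps_trunc (mdeg u).+1 f) _ _ (ltnSn _)); last first.
  by move=> v; apply: fps_trunc_coef.
rewrite comp_widen_mwiden; case: eqP => [e|e].
  rewrite -{1}[u]mnm_restrK e mulm0n addm0 mwiden_mnmwiden fps_trunc_coef //.
  rewrite ltnS -{2}[u]mnm_restrK mdegD; apply: leq_trans (leq_addr _ _).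
  rewrite !mdegE big_ord_recr /= mnmwiden_ordmax addn0.
  by apply: leq_sum => i _; rewrite mnmwiden_widen.
rewrite -comp_widen_mwiden comp_mpolyEX raddf_sum /= big1 // => m _.
rewrite comp_widen_mwiden mwidenX mcoeffZ mcoeffX; case: eqP => [h|_]; last by rewrite mulr0.
by case: e; rewrite -h mnmwiden_ordmax.
Qed.

(** The map is contracting: each coefficient of [T f] depends only on coefficients of [f] at smaller
    [deg]. At a given index the iterates from 0 become stationary, and the stationary values form
    the fixed point. *)
Lemma fps_fixpoint (deg : 'X_{1..n.+1} -> nat) (T : fps n.+1 R -> fps n.+1 R) :
    (forall f g u, (forall v, (deg v < deg u)%N -> fps_coef f v = fps_coef g v) ->
       fps_coef (T f) u = fps_coef (T g) u) ->
  exists q, q = T q.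
Proof.
move=> hT; have agree k k' u : (deg u < k)%N -> (deg u < k')%N ->
    fps_coef (iter k T 0) u = fps_coef (iter k' T 0) u.
  elim: k k' u => // k ih [//|k'] u hk hk' /=; apply: hT => v hv.
  by apply: ih; apply: leq_trans hv _; rewrite -ltnS.
exists (Fps (fun u => fps_coef (iter (deg u).+1 T 0) u)).
apply/fpsP => u /=; apply: hT => v hv /=.
by apply: (agree _ (deg v).+1).
Qed.

Variables (N : nat) (E : fps n.+1 R).
Hypothesis E0 : forall u, mnm_restr u = 0%MM -> fps_coef E u = 0.
Let Z : fps n.+1 R := fps_of_mpoly 'X_(ord_max).
Let F : fps n.+1 R := Z ^+ N + E.
Let iota := fps_subst widen_subst.

Let ZXE k : Z ^+ k = fps_of_mpoly 'X_[U_(ord_max) *+ k].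
Proof. by rewrite /Z -rmorphXn /= mpolyXn. Qed.

(** [shift] drops the terms of degree below $N$ in $Z$ and divides the rest by $Z^N$. Thus $g - q F$
    has degree below $N$ in $Z$ when [q] equals [shift g - shift (q * E)]; this equation has a
    solution because multiplication by [E] raises the degree in the first [n] variables. *)
Lemma weierstrass_division_low g :
  exists q r, g = q * F + r /\ forall u, (N <= u ord_max)%N -> fps_coef r u = 0.
Proof.
pose shift f : fps n.+1 R := Fps (fun u => fps_coef f (u + U_(ord_max) *+ N)%MM).
have [|q hq] := @fps_fixpoint (fun u => mdeg (mnm_restr u))
    (fun q => shift g - shift (q * E)).
  move=> f f' u hff; rewrite !fps_coefB; congr (_ - _).
  rewrite [LHS]fps_coefM [RHS]fps_coefM; apply: eq_bigr => k.
  move: (bmnm k) => {}k hk; have hr : (mnm_restr u = mnm_restr (u + U_(ord_max) *+ N - k) + mnm_restr k)%MM.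
    by rewrite -mnm_restrD submK // mnm_restrD mnm_restr_max addm0.
  have [e|ne] := eqVneq (mnm_restr (u + U_(ord_max) *+ N - k)) 0%MM.
    by rewrite E0 // !mulr0.
  by rewrite hff // hr mdegD addnC -addn1 leq_add2l lt0n mdeg_eq0.
exists q, (g - q * F); split; first by rewrite addrC subrK.
move=> u hu; have hu' : (U_(ord_max) *+ N <= u)%MM.
  by apply/mnm_lepP => i; rewrite mulmnE mnm1E; case: eqP => [<-|_]; rewrite ?mul1n.
rewrite /F mulrDr ZXE !(fps_coefB, fps_coefD) fps_coefMX hu' {1}hq.
by rewrite !fps_coefB /= submK // subrK subrr.
Qed.

Lemma weierstrass_division g :
  exists q (r : 'I_N -> fps n R), g = q * F + \sum_(j < N) iota (r j) * Z ^+ j.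
Proof.
have [q [r [-> hr]]] := weierstrass_division_low g.
exists q, (fun j => Fps (fun v : 'X_{1..n} => fps_coef r (mnmwiden v + U_(ord_max) *+ j)%MM)).
congr (_ + _); apply/fpsP => u; rewrite fps_coef_sum.
under eq_bigr => j _ do rewrite ZXE fps_coefMX /iota fps_widen_coef.
have le j : (U_(ord_max) *+ j <= u)%MM = (j <= u ord_max)%N.
  apply/mnm_lepP/idP => [/(_ ord_max)|h i]; rewrite mulmnE mnm1E ?eqxx ?mul1n //.
  by case: eqP => [<-|_]; rewrite ?mul1n.
have umax j : (u - U_(ord_max) *+ j)%MM ord_max = (u ord_max - j)%N.
  by rewrite mnmBE mulmnE mnm1E eqxx mul1n.
case: (ltnP (u ord_max) N) => hu; last first.
  rewrite hr // big1 // => j _; rewrite le umax; case: ifP => // hj.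
  by rewrite subn_eq0 leqNgt (leq_trans (ltn_ord j)).
rewrite (bigD1 (Ordinal hu)) //= le leqnn umax subnn eqxx big1 ?addr0.
  have -> : mnm_restr (u - U_(ord_max) *+ u ord_max) = mnm_restr u.
    have h : (U_(ord_max) *+ u ord_max <= u)%MM by rewrite le.
    by rewrite -[in RHS](submK h) mnm_restrD mnm_restr_max addm0.
  by rewrite mnm_restrK.
move=> j ji; rewrite le umax; case: ifP => // hj; rewrite subn_eq0; case: ifP => // hj'.
by case/eqP: ji; apply/val_inj/eqP; rewrite /= eqn_leq hj hj'.
Qed.

(* Cayley-Hamilton for the multiplication by [g] modulo [F] on 1, Z, ..., Z^(N-1). *)
Lemma weierstrass_integral g : (0 < N)%N ->
  exists2 p : {poly fps n R}, p \is monic & exists h, (map_poly iota p).[g] = h * F.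
Proof.
move=> N0; pose div j := weierstrass_division (g * Z ^+ j).
have /choice [q hq] := div; have /choice [r hr] := hq.
pose M := \matrix_(j < N, k < N) r j k.
pose v := \col_(k < N) Z ^+ k.
pose A := g%:M - map_mx iota M.
have hA : A *m v = F *: \col_(j < N) q j.
  apply/colP => j; rewrite mulmxBl mul_scalar_mx !mxE hr.
  rewrite (_ : \sum_(k < N) _ = \sum_(k < N) iota (r j k) * Z ^+ k).
    by rewrite addrK mulrC.
  by apply: eq_bigr => k _; rewrite !mxE.
have detA : \det A = (map_poly iota (char_poly M)).[g].
  rewrite map_char_poly /char_poly -[RHS]/(horner_eval g _) -det_map_mx.
  congr (\det _); apply/matrixP => i j; rewrite !mxE /horner_eval /=.
  by rewrite /horner_eval hornerD hornerN hornerMn hornerX hornerC.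
exists (char_poly M); first exact: char_poly_monic.
(* The adjugate turns the system into $\det A \cdot v \in (F)$ entrywise; the entry at index 0 of
   $v$ is $Z^0 = 1$, which exists as $N > 0$. *)
have := congr1 (mulmx (\adj A)) hA.
rewrite mulmxA mul_adj_mx mul_scalar_mx -scalemxAr => /colP /(_ (Ordinal N0)).
rewrite !mxE expr0 mulr1 detA => ->; eexists; exact: mulrC.
Qed.

End Weierstrass.

(** * Height one *)

(** Incomparability in integral extensions. If $g \in Q'$ satisfies a monic relation modulo $Q$, its
    constant term lies in $Q'$, hence in $Q$ by the hypothesis on traces. So $g$ times a monic
    expression of lower degree lies in $Q$, and primality gives $g \in Q$ or a shorter relation. *)
Lemma prime_incomparable (A B : comNzRingType) (iota : {rmorphism B -> A})
    (Q Q' : set A) :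
    prime_ideal Q -> prime_ideal Q' -> Q `<=` Q' ->
    (forall g, exists2 p : {poly B}, p \is monic & Q (map_poly iota p).[g]) ->
    (forall b, Q' (iota b) -> Q (iota b)) ->
  Q' `<=` Q.
Proof.
move=> hQ hQ' QQ' int hB g hg; have [p] := int g.
elim/poly_ind: p => [|p c ih].
  by rewrite monicE lead_coef0 eq_sym oner_eq0.
have [-> | p0] := eqVneq p 0.
  rewrite mul0r add0r => /monicP; rewrite lead_coefC => ->.
  by rewrite rmorph1 hornerC => /(prime_ideal1 hQ).
have sz : (size (c%:P) < size (p * 'X)%R)%N.
  by rewrite size_mulX // ltnS (leq_trans (size_polyC_leq1 _)) // size_poly_gt0.
rewrite monicE lead_coefDl // lead_coefMX -monicE => pm.
rewrite rmorphD rmorphM /= map_polyX map_polyC hornerD hornerMX hornerC => h.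
have hc : Q (iota c).
  apply: hB; rewrite -[iota c](addKr ((map_poly iota p).[g] * g)) addrC.
  apply: (prime_idealB hQ'); first exact: QQ'.
  exact: prime_idealM.
have : Q ((map_poly iota p).[g] * g).
  by rewrite -[_ * g](addrK (iota c)); apply: prime_idealB.
by case/(prime_ideal_prod hQ) => // /(ih pm).
Qed.

Lemma prime_ideal_ker (A : comNzRingType) (B : idomainType)
    (phi : {rmorphism A -> B}) : prime_ideal [set f | phi f = 0].
Proof.
apply: prime_idealI => /=; first exact: rmorph0.
- by rewrite rmorph1 => /eqP; rewrite oner_eq0.
- by move=> a f g hf hg; rewrite rmorphD rmorphM hf hg mulr0 addr0.
by move=> f g; rewrite rmorphM => /eqP; rewrite mulf_eq0 => /orP[] /eqP; [left|right].
Qed.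

(** * Primes of the hypersurface ring *)

Section Quotient.
Context (A : comUnitRingType) (F : A) (F_nonunit : F \isn't a GRing.unit).
Local Notation pi := (hypersurface_proj F_nonunit).

Lemma hypersurface_proj_zmod : zmod_morphism pi.
Proof. exact: rmorphB. Qed.

Lemma hypersurface_proj_monoid : monoid_morphism pi.
Proof. by split; [exact: rmorph1 | exact: rmorphM]. Qed.

HB.instance Definition _ := GRing.isZmodMorphism.Build A
  (hypersurface_ring F_nonunit) pi hypersurface_proj_zmod.
HB.instance Definition _ := GRing.isMonoidMorphism.Build A
  (hypersurface_ring F_nonunit) pi hypersurface_proj_monoid.

Lemma hypersurface_proj_eq f g : pi f = pi g <-> exists h, f - g = h * F.
Proof.
have := Quotient.idealrBE (principal_ideal F_nonunit) f g.
rewrite /in_mem /= => e; split=> [h|h].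
  by apply/asboolP; rewrite [asbool _]e; apply/eqP.
by apply/eqP; rewrite -[_ == _]e; apply/asboolP.
Qed.

Lemma hypersurface_proj_surj y : exists f, y = pi f.
Proof. by exists (repr y); rewrite /hypersurface_proj reprK. Qed.

Section Image.
Variable Q : set A.
Hypotheses (hQ : prime_ideal Q) (QF : Q F).

(** An ideal containing [F] is saturated for the projection, so nothing is lost by passing to its
    image. *)
Lemma image_projE f : (pi @` Q) (pi f) <-> Q f.
Proof.
split=> [[g Qg /hypersurface_proj_eq [h e]]|Qf]; last by exists f.
rewrite -[f](subKr g) e; apply: prime_idealB => //.
exact: prime_idealM.
Qed.

Lemma image_proj_prime : prime_ideal (pi @` Q).
Proof.
apply: prime_idealI.
- by rewrite -(rmorph0 pi); apply/image_projE; apply: prime_ideal0.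
- by rewrite -(rmorph1 pi) => /image_projE /(prime_ideal1 hQ).
- move=> a _ _ [f Qf <-] [g Qg <-]; have [b ->] := hypersurface_proj_surj a.
  by rewrite -rmorphM -rmorphD; apply/image_projE; apply: prime_ideal_lin.
move=> f g; have [f' ->] := hypersurface_proj_surj f.
have [g' ->] := hypersurface_proj_surj g.
rewrite -rmorphM => /image_projE /(prime_ideal_prod hQ) [] h; [left|right];
exact/image_projE.
Qed.

End Image.

Lemma preimage_proj_prime (Q : set (hypersurface_ring F_nonunit)) :
  prime_ideal Q -> prime_ideal (pi @^-1` Q) /\ (pi @^-1` Q) F.
Proof.
move=> hQ; split; last first.
  rewrite /preimage /= (_ : pi F = 0); first exact: prime_ideal0.
  by rewrite -(rmorph0 pi); apply/hypersurface_proj_eq; exists 1; rewrite subr0 mul1r.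
apply: prime_idealI; rewrite /preimage /=.
- by rewrite rmorph0; apply: prime_ideal0.
- by rewrite rmorph1; apply: prime_ideal1.
- by move=> a f g; rewrite rmorphD rmorphM; apply: prime_ideal_lin.
by move=> f g; rewrite rmorphM; apply: prime_ideal_prod.
Qed.

End Quotient.

(** The images of [Q0] and [P] form a chain of length 1. The last three primes of a longer chain in
    the quotient would pull back to a chain forbidden by the last hypothesis. *)
Lemma has_height_mod1 (A : comUnitRingType) (F : A) (P Q0 : set A) :
    prime_ideal P -> prime_ideal Q0 -> Q0 F -> Q0 `<` P ->
    (forall Q Q', prime_ideal Q -> prime_ideal Q' -> Q F ->
       Q `<` Q' -> Q' `<` P -> False) ->
  has_height_mod F P 1.
Proof.
move=> hP hQ0 Q0F [Q0P PQ0] hmax; have PF : P F by apply: Q0P.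
have nonunit : F \isn't a GRing.unit.
  apply/negP => Fu; apply: (prime_ideal1 hP); rewrite -(mulVr Fu).
  exact: prime_idealM.
exists nonunit; split.
  exists (fun i => hypersurface_proj nonunit @` (if i == 0 :> nat then Q0 else P)).
  split=> //.
  - by move=> i; case: ifP => _; apply: image_proj_prime.
  move=> [[|[|//]] hi] [[|[|//]] hj] //= _; split.
    by move=> _ [f Qf <-]; exists f => //; apply: Q0P.
  move=> h; apply: PQ0 => f Pf; apply/(image_projE nonunit hQ0 Q0F).
  by apply: h; exists f.
move=> k [Q [hQ Qlt Qmax]]; rewrite leqNgt; apply/negP => k2.
(* As $k \geq 2$, the indices $k - 2$ and $k - 1$ are the two just below the top index $k$, which
   carries the image of [P]. *)
have k1 : (k.-1 < k.+1)%N by lia.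
have k0 : (k.-2 < k.+1)%N by lia.
pose q1 := Q (Ordinal k1); pose q0 := Q (Ordinal k0).
have [h01 n01] : q0 `<` q1 by apply: Qlt => /=; lia.
have [h1P n1P] : q1 `<` hypersurface_proj nonunit @` P.
  by rewrite -Qmax; apply: Qlt => /=; lia.
have [p0 F0] := preimage_proj_prime (hQ (Ordinal k0)).
have [p1 _] := preimage_proj_prime (hQ (Ordinal k1)).
apply: (hmax _ _ p0 p1 F0); split.
- by move=> f; apply: h01.
- move=> h; apply: n01 => y; have [f ->] := hypersurface_proj_surj y.
  exact: h.
- by move=> f /h1P /(image_projE nonunit hP PF).
move=> h; apply: n1P => y [f Pf <-]; exact: h.
Qed.

(** * The curve in the equimultiple locus of $F_2$ *)

Section Curve.
Context (C : numClosedFieldType).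
Local Notation T1 := ('X_(@Ordinal 1 0 isT) : {mpoly C[1]}).
Local Notation F a := (fps_of_mpoly (surface_mpoly C a)).
Local Notation iota := (fps_subst (widen_subst 2 C)).

(** At $X = Y = 0$ the equation is $Z^8$. The cofactors [p] of $X$ and [q] of $Y$ in the rest come
    from $Q^2 + c^2 X Y - 4 Z^2 L = Z^4 + G$. *)
Lemma surface_weierstrass a : exists2 E : fps 3 C,
  F a = fps_of_mpoly 'X_ord_max ^+ 8 + E &
  forall u, mnm_restr u = 0%MM -> fps_coef E u = 0.
Proof.
pose c : {mpoly C[3]} := 4 - a%:R ^+ 2; pose L : {mpoly C[3]} := 4 * X3 + Y3.
pose G := L * (L - 2 * Z3 ^+ 2) + c ^+ 2 * X3 * Y3.
pose q := (L - 2 * Z3 ^+ 2) * (2 * Z3 ^+ 4 + G).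
pose p := 4 * q + c ^+ 2 * Y3 * (2 * Z3 ^+ 4 + G)
  - Y3 * (2 * c * (Z3 ^+ 2 + L) - 16 * Z3 ^+ 2) ^+ 2.
exists (fps_of_mpoly (p * X3 + q * Y3)).
  rewrite (_ : ord_max = @Ordinal 3 2 isT); last exact/val_inj.
  rewrite -rmorphXn -rmorphD; congr fps_of_mpoly.
  by rewrite /surface_mpoly /surface /p /q /G /L /c; ring.
move=> u /mnmP hu; rewrite rmorphD !rmorphM fps_coefD !fps_coefMX.
have h (i : 'I_3) (j : 'I_2) : widen_ord (leqnSn 2) j = i -> (U_(i) <= u)%MM = false.
  move=> <-; apply/mnm_lepP => /(_ (widen_ord (leqnSn 2) j)).
  by rewrite mnm1E eqxx; have := hu j; rewrite mnmE mnm0E => ->.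
rewrite (h _ (@Ordinal 2 0 isT)) ?(h _ (@Ordinal 2 1 isT)) ?addr0 //; exact/val_inj.
Qed.

Lemma surface_integral a (g : fps 3 C) :
  exists2 p : {poly fps 2 C}, p \is monic & exists h, (map_poly iota p).[g] = h * F a.
Proof.
have [E -> hE] := surface_weierstrass a.
exact: weierstrass_integral.
Qed.

Fact curve_subst0 i :
  (tnth [tuple T1 ^+ 4; - 4 * T1 ^+ 4; 0] i)@_0%MM = 0.
Proof.
have h : (T1 ^+ 4)@_0%MM = 0 by rewrite mcoeffXn -mdeg_eq0 mdegMn mdeg1.
case: i => [[|[|[|//]]] hi] //=; rewrite (tnth_nth 0) /= ?mcoeff0 //.
by rewrite (mcoeff0_is_multiplicative _ _).1 h mulr0.
Qed.

(** The parametrization $X = t^4$, $Y = -4 t^4$, $Z = 0$ of the curve $Z = L = 0$. Defining the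
    ideal as a kernel makes its primality immediate, and the fourth powers let the map factor
    through the branch of $\zeta_2$. *)
Definition curve_subst := MpolySubst curve_subst0.

Definition curve_ideal : set (fps 3 C) := [set f | fps_subst curve_subst f = 0].

Fact curve_param_subst0 i : (tnth [tuple T1; ('i - 1) *: T1] i)@_0%MM = 0.
Proof.
have h : T1@_0%MM = 0 by rewrite mcoeffX mnm1_eq0.
by case: i => [[|[|//]] hi] //=; rewrite (tnth_nth 0) /= ?mcoeffZ h ?mulr0.
Qed.

(** The line $x = t$, $y = (i - 1) t$: here $(i - 1)^4 = -4$ and $\zeta_2$ vanishes on it. *)
Definition curve_param_subst := MpolySubst curve_param_subst0.

Fact branch_subst0 a i :
  (tnth [tuple X2 ^+ 4; Y2 ^+ 4; branch_mpoly a (1 : C) 1] i)@_0%MM = 0.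
Proof.
case: i => [[|[|[|//]]] hi] //=; rewrite (tnth_nth 0) /=.
- by rewrite mcoeffXn -mdeg_eq0 mdegMn mdeg1.
- by rewrite mcoeffXn -mdeg_eq0 mdegMn mdeg1.
by rewrite mcoeff_branch -!mdeg_eq0 !(mdegD, mdegMn, mdeg1) !mulr0 !addr0.
Qed.

Definition branch_subst a := MpolySubst (branch_subst0 a).

Lemma branch_subst_surface a : fps_subst (branch_subst a) (F a) = 0.
Proof.
rewrite fps_subst_mpoly rmorph_surface /= !comp_mpoly_var !(tnth_nth 0) /=.
rewrite -(@surface_conjugates _ a 'i%:MP); last by rewrite -rmorphXn sqrCi rmorphN1.
by rewrite big_cons /branch_mpoly mpolyC1 subrr mul0r rmorph0.
Qed.

(** The curve lies on the branch; hence the kernel of [branch_subst 2] is contained in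
    [curve_ideal]. *)
Lemma curve_subst_branch f :
  fps_subst curve_subst f =
  fps_subst curve_param_subst (fps_subst (branch_subst 2) f).
Proof.
have i2 : ('i%:MP : {mpoly C[1]}) ^+ 2 = -1 by rewrite -rmorphXn sqrCi rmorphN1.
symmetry; apply: fps_subst_comp => i.
case: i => [[|[|[|//]]] hi] /=; rewrite !(tnth_nth 0) /=.
- by rewrite rmorphXn /= comp_mpoly_var (tnth_nth 0).
- rewrite rmorphXn /= comp_mpoly_var (tnth_nth 0) /= -mul_mpolyC rmorphB rmorph1.
  by ring: i2.
rewrite /branch_mpoly rmorph_conjugate /= !comp_mpolyC !comp_mpoly_var !(tnth_nth 0) /=.
rewrite -mul_mpolyC rmorphB rmorph1 /conjugate; by ring: i2.
Qed.

Lemma curve_ideal_prime : prime_ideal curve_ideal.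
Proof. exact: prime_ideal_ker. Qed.

Lemma curve_ideal_Z : curve_ideal (fps_of_mpoly Z3).
Proof.
by rewrite /curve_ideal /= fps_subst_mpoly comp_mpoly_var (tnth_nth 0) /= rmorph0.
Qed.

Lemma curve_ideal_Q : curve_ideal (fps_of_mpoly (quadric C)).
Proof.
rewrite /curve_ideal /= fps_subst_mpoly /quadric !(rmorph_nat, rmorphXn, rmorphM, rmorphD) /=.
rewrite !comp_mpoly_var !(tnth_nth 0) /=.
rewrite (_ : _ + _ = 0) ?rmorph0 //; ring.
Qed.

Definition tangent_line : fps 2 C := fps_of_mpoly (4 * X2 + Y2).

Lemma curve_ideal_tangent_line : curve_ideal (iota tangent_line).
Proof.
rewrite /curve_ideal /tangent_line /= !fps_subst_mpoly.
rewrite (_ : (_ \mPo _) = 0) ?rmorph0 // !(rmorph_nat, rmorphM, rmorphD) /=.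
rewrite !comp_mpoly_var !tnth_mktuple !comp_mpoly_var !(tnth_nth 0) /=; ring.
Qed.

(** Division by $L = Y + 4 X$, of degree 1 in $Y$, leaves a remainder $r(X)$. On the curve it
    becomes $r(t^4) = 0$, and substitution of a power is injective. *)
Lemma curve_ideal_contract b : curve_ideal (iota b) -> exists b', b = tangent_line * b'.
Proof.
move=> hb.
have E0 u : mnm_restr u = 0%MM -> fps_coef (fps_of_mpoly (4 * X2) : fps 2 C) u = 0.
  move=> /mnmP hu; rewrite rmorphM fps_coefMX; case: ifP => // /mnm_lepP.
  move/(_ (@Ordinal 2 0 isT)); rewrite mnm1E eqxx.
  have := hu (@Ordinal 1 0 isT); rewrite mnmE mnm0E.
  by rewrite (_ : widen_ord _ _ = @Ordinal 2 0 isT) => [->|]; last exact/val_inj.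
have [q [r]] := weierstrass_division 1 E0 b.
rewrite big_ord1 expr0 mulr1 expr1.
rewrite (_ : fps_of_mpoly 'X_ord_max + _ = tangent_line); last first.
  rewrite -rmorphD addrC /tangent_line (_ : ord_max = @Ordinal 2 1 isT) //.
  exact/val_inj.
move=> e; exists q; rewrite {1}e mulrC.
have m0 : (0 < 4)%N by [].
have r0 : r ord0 = 0.
  apply: (fps_subst_pow_inj m0).
  rewrite !(fps_subst_powE 1 C m0) rmorph0.
  move: hb; rewrite /curve_ideal /= e !rmorphD !rmorphM.
  have /= -> := curve_ideal_tangent_line; rewrite mulr0 add0r => <-.
  have h1 : forall i, tnth (widen_subst 1 C) i \mPo [tuple T1 ^+ 4; - 4 * T1 ^+ 4]
      = tnth (pow_subst 1 C m0) i.
    move=> i; rewrite !tnth_mktuple comp_mpoly_var (tnth_nth 0).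
    by rewrite (ord1 i) /=; congr ('X__ ^+ 4); exact/val_inj.
  (* The first two components of [curve_subst] form a substitution in two variables, through which
     both sides are compared. *)
  have s0 i : (tnth [tuple T1 ^+ 4; - 4 * T1 ^+ 4] i)@_0%MM = 0.
    have := curve_subst0 (widen_ord (leqnSn 2) i).
    by rewrite !(tnth_nth 0); case: i => [[|[|//]] hi].
  rewrite -(@fps_subst_comp _ _ _ _ (widen_subst 1 C) (MpolySubst s0) _ _ h1).
  symmetry; apply: fps_subst_comp => i; rewrite tnth_mktuple comp_mpoly_var.
  by rewrite !(tnth_nth 0); case: i => [[|[|//]] hi].
by rewrite r0 rmorph0 addr0.
Qed.

(** $L$ has no constant term; this drives the descent that shows a trace to be zero. *)
Lemma tangent_line_mul_order b d :
  (forall u, (mdeg u < d)%N -> fps_coef b u = 0) ->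
  forall u, (mdeg u < d.+1)%N -> fps_coef (tangent_line * b) u = 0.
Proof.
move=> hb u hu; rewrite (fps_coefM_trunc _ _ (ltnSn (mdeg u))).
apply: (@mcoeffM_order _ _ _ _ 1 d) => // v.
  rewrite ltnS leqn0 mdeg_eq0 => /eqP ->; rewrite fps_truncE; case: ifP => // _.
  rewrite fps_coef_mpoly mcoeffD (mcoeff0_is_multiplicative _ _).1 !mcoeffX.
  by rewrite !mnm1_eq0 mulr0 addr0.
by move=> hv; rewrite fps_truncE; case: ifP => // _; apply: hb.
Qed.

(** The prime below [curve_ideal] is the kernel of the branch. A prime strictly between two others
    is excluded by incomparability: its trace on the series in $X, Y$ would be either all of $(L)$
    or 0. *)
Lemma surface2_height1 : has_height_mod (F 2) curve_ideal 1.
Proof.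
pose Q0 : set (fps 3 C) := [set f | fps_subst (branch_subst 2) f = 0].
have hP := curve_ideal_prime.
have int Q (hQ : prime_ideal Q) (QF : Q (F 2)) g :
    exists2 p : {poly fps 2 C}, p \is monic & Q (map_poly iota p).[g].
  have [p pm [h e]] := surface_integral 2 g; exists p => //; rewrite e.
  exact: prime_idealM.
apply: (@has_height_mod1 _ _ _ Q0) => //.
- exact: prime_ideal_ker.
- exact: branch_subst_surface.
- split=> [f|/(_ _ curve_ideal_Z)].
    by rewrite /Q0 /curve_ideal /= curve_subst_branch => ->; rewrite rmorph0.
  rewrite /Q0 /= fps_subst_mpoly comp_mpoly_var (tnth_nth 0) /= => h.
  have [_ _ e3] := branch_triple 2 (1 : C) 1.
  move: h => /fpsP /(_ (U_(@Ordinal 2 1 isT) *+ 2)%MM).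
  by rewrite fps_coef_mpoly e3 expr1n => /eqP; rewrite oner_eq0.
move=> Q Q' hQ hQ' QF [QQ' nQQ'] [Q'P nQ'P].
have Q'F : Q' (F 2) by apply: QQ'.
(* If $L$ were in $Q'$, then $Q'$ and [curve_ideal] would have the same trace and hence coincide. *)
have nline : ~ Q' (iota tangent_line).
  move=> h; apply: nQ'P; apply: (prime_incomparable hQ' hP Q'P (int _ hQ' Q'F)).
  move=> b /curve_ideal_contract [b' ->]; rewrite rmorphM mulrC.
  exact: prime_idealM.
(* Infinite descent: an element of the trace of $Q'$ is $L b'$, and $b'$ is again in the trace since
   $L \notin Q'$. It is thus divisible by every power of $L$. *)
have contract0 d b : Q' (iota b) -> forall u, (mdeg u < d)%N -> fps_coef b u = 0.
  elim: d b => // d ih b hb.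
  have [b' e] := curve_ideal_contract (Q'P _ hb); rewrite e.
  apply: tangent_line_mul_order; apply: ih.
  by move: hb; rewrite e rmorphM => /(prime_ideal_prod hQ') [].
apply: nQQ'; apply: (prime_incomparable hQ hQ' QQ' (int _ hQ QF)) => b hb.
have -> : b = 0 by apply/fpsP => u; apply: (contract0 (mdeg u).+1 b hb).
by rewrite rmorph0; apply: prime_ideal0.
Qed.

End Curve.

(** * The pair $\zeta_2$, $\zeta_3$ as a counterexample for both statements *)

Lemma tangent_cone_equimultiple_locus_not_combinatorial (C : numClosedFieldType) :
  (exists (m : nat) (z1 z2 : fps 2 C) (F1 F2 : {poly fps 2 C})
      (r1 r2 : nat),
    (0 < m)%N /\
    exponents z1 = exponents z2 /\
    exponents z1 `&` [set u : 'X_{1..2} | forall i, (m %| u i)%N] = set0 /\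
    puiseux_order m z1 = puiseux_order m z2 /\
    (puiseux_order m z1 < 1)%E /\
    puiseux_minpoly m z1 F1 /\
    puiseux_minpoly m z2 F2 /\
    has_distinct_linear_factors (initial_form (fps_of_poly F1)) r1 /\
    has_distinct_linear_factors (initial_form (fps_of_poly F2)) r2 /\
    r1 <> r2)
  /\
  (exists (m : nat) (z1 z2 : fps 2 C) (F1 F2 : {poly fps 2 C}),
    (0 < m)%N /\
    exponents z1 = exponents z2 /\
    exponents z1 `&` [set u : 'X_{1..2} | forall i, (m %| u i)%N] = set0 /\
    puiseux_minpoly m z1 F1 /\
    puiseux_minpoly m z2 F2 /\
    (exists P : set (fps 3 C),
      equimultiple_locus (fps_of_poly F1) P /\
      has_height_mod (fps_of_poly F1) P 1) /\
    equimultiple_locus (fps_of_poly F2) = [set closed_point 3 C]).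
Proof.
have order a : puiseux_order 4 (branch C a) = ((2%:R / 4%:R)%:E : \bar rat).
  exact: branch_puiseux_order.
have same a b : (0 < a)%N -> (0 < b)%N ->
    exponents (branch C a) = exponents (branch C b).
  by move=> a0 b0; apply: etrans (exponents_branch C a0) (esym (exponents_branch C b0)).
have no_int a : (0 < a)%N ->
    exponents (branch C a) `&` [set u : 'X_{1..2} | forall i, (4 %| u i)%N] = set0.
  by move=> a0; rewrite (exponents_branch C a0) branch_exponents_not_dvd.
have cone a : initial_form (fps_of_poly (surface_poly C a)) = tangent_cone C a.
  by rewrite fps_of_surface_poly surface_initial_form.
split.
  (* The last two witnesses count the distinct factors of $L^4$ and of $(16 X - Y)^2 (X - Y)^2$. *)
  exists 4%N, (branch C 2), (branch C 3), (surface_poly C 2),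
    (surface_poly C 3), 1%N, 2%N.
  split; first by [].
  split; first exact: (same 2 3).
  split; first exact: (no_int 2).
  split; first exact: etrans (order 2) (esym (order 3)).
  split; first by rewrite (order 2).
  split; first exact: (@branch_minpoly C 2).
  split; first exact: (@branch_minpoly C 3).
  split; first by rewrite (cone 2); exact: tangent_cone2_factors.
  split; first by rewrite (cone 3); exact: tangent_cone3_factors.
  by [].
exists 4%N, (branch C 2), (branch C 3), (surface_poly C 2),
  (surface_poly C 3).
split; first by [].
split; first exact: (same 2 3).
split; first exact: (no_int 2).
split; first exact: (@branch_minpoly C 2).
split; first exact: (@branch_minpoly C 3).
split; last first.
  by rewrite (fps_of_surface_poly C 3); exact: surface3_equimultiple_locus.
rewrite (fps_of_surface_poly C 2).
exists (@curve_ideal C); split; last exact: surface2_height1.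
have hP := @curve_ideal_prime C; split; first exact: hP.
rewrite (surface_order C 2); apply: (prime_ideal_symbolic_power hP).
by apply: surface2_ideal_power; [exact: curve_ideal_Z | exact: curve_ideal_Q].
Qed.

Theorem mainTheorem3 (R : realType) :
  (exists (m : nat) (z1 z2 : fps 2 R[i]) (F1 F2 : {poly fps 2 R[i]})
      (r1 r2 : nat),
    (0 < m)%N /\
    exponents z1 = exponents z2 /\
    exponents z1 `&` [set u : 'X_{1..2} | forall i, (m %| u i)%N] = set0 /\
    puiseux_order m z1 = puiseux_order m z2 /\
    (puiseux_order m z1 < 1)%E /\
    puiseux_minpoly m z1 F1 /\
    puiseux_minpoly m z2 F2 /\
    has_distinct_linear_factors (initial_form (fps_of_poly F1)) r1 /\
    has_distinct_linear_factors (initial_form (fps_of_poly F2)) r2 /\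
    r1 <> r2)
  /\
  (exists (m : nat) (z1 z2 : fps 2 R[i]) (F1 F2 : {poly fps 2 R[i]}),
    (0 < m)%N /\
    exponents z1 = exponents z2 /\
    exponents z1 `&` [set u : 'X_{1..2} | forall i, (m %| u i)%N] = set0 /\
    puiseux_minpoly m z1 F1 /\
    puiseux_minpoly m z2 F2 /\
    (exists P : set (fps 3 R[i]),
      equimultiple_locus (fps_of_poly F1) P /\
      has_height_mod (fps_of_poly F1) P 1) /\
    equimultiple_locus (fps_of_poly F2) = [set closed_point 3 R[i]]).
Proof. exact: (tangent_cone_equimultiple_locus_not_combinatorial R[i]). Qed.
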